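(* Let $n\ge 2$, let $\Omega\subseteq\mathbb{R}^n$ be a bounded open set with $|\partial\Omega|<+\infty$, and let $x_0\in\Omega$. If $\partial\Omega$ is a harmonic pseudosphere centered at $x_0$, then $$S_z(\partial\Omega,x_0)\geq 1\quad\text{for every } z\in T(\partial\Omega,x_0).$$
   Context: Notation: $\sigma$ is the $(n-1)$-dimensional Hausdorff measure in $\mathbb{R}^n$, $|\partial\Omega|$ denotes the $(n-1)$-Hausdorff measure of the topological boundary, $\fint_{\partial\Omega}u\,d\sigma=\frac1{|\partial\Omega|}\int_{\partial\Omega}u\,d\sigma$, $\omega_n$ is the Lebesgue measure of the unit ball of $\mathbb{R}^n$, $B(x,\rho)$ is the open Euclidean ball. Harmonic pseudosphere: for $\Omega\subseteq\mathbb{R}^n$ bounded open with $|\partial\Omega|<+\infty$ and $x_0\in\Omega$, $\partial\Omega$ is called a harmonic pseudosphere centered at $x_0$ if $u(x_0)=\fint_{\partial\Omega}u\,d\sigma$ for every function $u$ harmonic in $\Omega$ and continuous up to $\partial\Omega$ (i.e. continuous on $\overline\Omega$). Touching set: $T(\partial\Omega,x_0):=\{z\in\partial\Omega: |x_0-z|=\mathrm{dist}(\partial\Omega,x_0)\}$. Spherical flatness index: let $\Omega$ be open with every compact subset of $\partial\Omega$ of finite $(n-1)$-Hausdorff measure, $x_0\in\Omega$, $z\in T(\partial\Omega,x_0)$, $r:=|z-x_0|$. Then $$S_z(\partial\Omega,x_0):=\frac{2}{n\omega_n r}\liminf_{R\searrow0}\left(\liminf_{\alpha\to z,\ \alpha\notin\overline\Omega}\int_{\partial\Omega\cap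 B(z,R)}\frac{\langle\alpha-x,\alpha-x_0\rangle}{|x-\alpha|^n}\,d\sigma(x)\right)\in[-\infty,+\infty],$$ where the inner $\liminf$ is $+\infty$ (the standard convention $\inf\emptyset=+\infty$) if no points $\alpha\notin\overline\Omega$ converge to $z$. *)

(* Defs.v *)
From HB Require Import structures.
From mathcomp Require Import all_boot all_order all_algebra.
From mathcomp Require Import all_classical all_reals all_analysis.

Set Implicit Arguments.
Unset Strict Implicit.
Unset Printing Implicit Defensive.

Import Order.TTheory GRing.Theory Num.Theory.
Import numFieldNormedType.Exports.

Local Open Scope classical_set_scope.
Local Open Scope ring_scope.

(* The norm that the library puts on 'rV[R]_n is the sup norm: its topology,
   bounded sets and directional derivatives are the usual ones, but lengths,
   balls and diameters need the Euclidean norm [enorm]. *)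
Section euclidean_space.
Context {R : realType} {n : nat}.
Implicit Types (x y u v : 'rV[R]_n) (A : set 'rV[R]_n).

Definition dotmul u v : R := \sum_(i < n) u 0 i * v 0 i.

Definition enorm u : R := Num.sqrt (dotmul u u).

Definition eball x (r : R) : set 'rV[R]_n := [set y | enorm (y - x) < r].

(* -oo when A is empty *)
Definition ediam A : \bar R :=
  ereal_sup [set (enorm (x - y))%:E | x in A & y in A].

Definition edist A x : R := inf [set enorm (x - y) | y in A].

Definition boundary A : set 'rV[R]_n := closure A `\` A°.

(* Coverings by the boxes ]a, b], encoded as pairs (a, b) with a <= b. *)
Definition lebesgue_outer A : \bar R :=
  ereal_inf [set (\sum_(k <oo) (\prod_(i < n) ((F k).2 0 i - (F k).1 0 i))%:E)%E
  | F in [set F : ('rV[R]_n * 'rV[R]_n)^nat |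
      (forall k i, (F k).1 0 i <= (F k).2 0 i) /\
      A `<=` \bigcup_k
        [set x | forall i, (F k).1 0 i < x 0 i <= (F k).2 0 i]]].

End euclidean_space.

(* For n > 0 the outer measure is finite, since the unit ball lies in a box.
   For n = 0 every box has volume 1 and the value is the junk 0, not 1. *)
Definition unit_ball_volume (R : realType) (n : nat) : R :=
  fine (lebesgue_outer (eball (0 : 'rV[R]_n) 1)).

(* The same construction as [mu_ext], with an arbitrary class C of covering
   sets in place of the measurable sets of a semiring. *)
Section cover_outer.
Local Open Scope ereal_scope.
Context {R : realType} {T : Type}.
Variables (C : set (set T)) (g : set T -> \bar R).

Definition cover_outer (X : set T) : \bar R :=
  ereal_inf [set \sum_(k <oo) g (A k) |
    A in [set A : (set T)^nat |
      (forall k, C (A k)) /\ X `<=` \bigcup_k A k]].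

Hypotheses (C0 : C set0) (g0 : g set0 = 0) (g_ge0 : forall X, 0 <= g X).

Lemma le_cover_outer : {homo cover_outer : A B / A `<=` B >-> A <= B}.
Proof.
move=> A B AB; apply/ereal_inf_le_tmp => x [B' [CB' BB']].
by move=> <-{x}; exists B' => //; split => //; apply: subset_trans AB BB'.
Qed.

Lemma cover_outer_ge0 A : 0 <= cover_outer A.
Proof.
by apply: le_ereal_inf_tmp => x [B _ <-{x}]; apply: nneseries_ge0.
Qed.

Lemma cover_outer0 : cover_outer set0 = 0.
Proof.
apply/eqP; rewrite eq_le cover_outer_ge0 andbT.
apply: ereal_inf_lbound; exists (fun=> set0); first by split.
by rewrite eseries0.
Qed.

Lemma cover_outer_sigma_subadditive : sigma_subadditive cover_outer.
Proof.
move=> A; have [[i ioo]|] := pselect (exists i, cover_outer (A i) = +oo).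
  rewrite (eseries_pinfty _ _ ioo) ?leey// => n _.
  by rewrite -ltNye (lt_le_trans _ (cover_outer_ge0 _)).
rewrite -forallNE => Aoo.
suff add2e (e : {posnum R}) : cover_outer (\bigcup_n A n) <=
    \sum_(i <oo) cover_outer (A i) + e%:num%:E.
  by apply/lee_addgt0Pr => _/posnumP[].
rewrite (le_trans _ (epsilon_trick _ _ _))//; last first.
  by move=> n; exact: cover_outer_ge0.
pose P n (B : (set T)^nat) :=
  ((forall k, C (B k)) /\ A n `<=` \bigcup_k B k) /\
  \sum_(k <oo) g (B k) <= cover_outer (A n) + (e%:num / (2 ^ n.+1)%:R)%:E.
have [G PG] : {G : ((set T)^nat)^nat & forall n, P n (G n)}.
  apply: (@choice _ _ P) => n; rewrite /P /cover_outer.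
  set S := (X in ereal_inf X); move infS : (ereal_inf S) => iS.
  case: iS infS => [r Sr|Soo|Soo].
  - have en1 : (0 < e%:num / (2 ^ n.+1)%:R)%R by [].
    have /(lb_ereal_inf_adherent en1) : ereal_inf S \is a fin_num by rewrite Sr.
    move=> [x [B [mB AnB] muBx] xS].
    by exists B; split => //; rewrite muBx -Sr; exact/ltW.
  - by have := Aoo n; rewrite /cover_outer Soo.
  - suff : lbound S 0 by move/le_ereal_inf_tmp; rewrite Soo.
    by move=> /= _ [B [mB AnB] <-]; exact: nneseries_ge0.
have gG_ge0 x : 0 <= (g \o uncurry G) x by exact: g_ge0.
apply: (@le_trans _ _ (\esum_(i in setT) (g \o uncurry G) i)).
  rewrite /cover_outer; apply: ereal_inf_lbound => /=.
  have /card_esym/ppcard_eqP[f] := card_nat2.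
  exists (uncurry G \o f).
    split => [i|]; first by rewrite /=; case: (f i) => a b; exact: (PG a).1.1.
    apply: (@subset_trans _  (\bigcup_n \bigcup_k G n k)) => [t [i _]|].
      by move=> /(PG i).1.2 -[j _ ?]; exists i => //; exists j.
    move=> t [i _ [j _ Bijt]]; exists (f^-1%FUN (i, j)) => //=.
    by rewrite invK ?inE.
  rewrite -(esum_pred_image (g \o uncurry G) _ xpredT) ?[fun=> _]set_true//.
  by rewrite image_eq.
rewrite (_ : esum _ _ = \sum_(i <oo) \sum_(j <oo ) g (G i j)); last first.
  pose J : nat -> set (nat * nat) := fun i => [set (i, j) | j in setT].
  rewrite (_ : setT = \bigcup_k J k); last first.
    by rewrite predeqE => -[a b]; split => // _; exists a => //; exists b.
  rewrite esum_bigcupT /=; last 2 first.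
    - apply/trivIsetP => i j _ _ ij.
      rewrite predeqE => -[n m] /=; split => //= -[] [_] _ [<-{n} _].
      by move=> [m' _] [] /esym/eqP; rewrite (negbTE ij).
    - by move=> /= [n m]; apply: g_ge0.
  rewrite -(image_id [set: nat]) -fun_true esum_pred_image//; last first.
    by move=> n _; exact: esum_ge0.
  apply: eq_eseriesr => /= j _.
  rewrite -(esum_pred_image (g \o uncurry G) (pair j) predT)//=; last first.
    by move=> ? ? _ _; exact: (@can_inj _ _ _ snd).
  by congr esum; rewrite predeqE => -[a b]; split; move=> [i _ <-]; exists i.
apply: lee_nneseries => [n _ _|n _].
- by apply: nneseries_ge0 => m *; exact: (gG_ge0 (n, m)).
- exact: (PG n).2.
Qed.

End cover_outer.

(* The normalizing factor makes the k-dimensional measure agree with surface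
   area (and with Lebesgue measure when k = n). The empty set is singled out
   because its [ediam] is -oo. Only k > 0 is meaningful: see
   [unit_ball_volume]. *)
Section hausdorff.
Local Open Scope ereal_scope.
Context {R : realType} {n : nat} (k : nat).
Implicit Types (A : set 'rV[R]_n) (d : R).

Definition hausdorff_gauge A : \bar R :=
  if A == set0 then 0
  else (unit_ball_volume R k / 2 ^+ k)%:E * ediam A ^+ k.

Definition hausdorff_pre d : set 'rV[R]_n -> \bar R :=
  cover_outer [set A | ediam A <= d%:E] hausdorff_gauge.

Definition hausdorff A : \bar R :=
  ereal_sup [set hausdorff_pre d A | d in [set d | (0 < d)%R]].

Lemma unit_ball_volume_ge0 : (0 <= unit_ball_volume R k)%R.
Proof.
apply: fine_ge0; apply: le_ereal_inf_tmp => _ [F [Fle _] <-].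
apply: nneseries_ge0 => m _ _; rewrite lee_fin prodr_ge0// => i _.
by rewrite subr_ge0.
Qed.

Lemma ediam0 : ediam (set0 : set 'rV[R]_n) = -oo.
Proof.
rewrite /ediam (_ : [set _ | _ in _ & _ in _] = set0) ?ereal_sup0//.
by apply/seteqP; split => // x [y []].
Qed.

Lemma hausdorff_gauge_ge0 A : 0 <= hausdorff_gauge A.
Proof.
rewrite /hausdorff_gauge; case: ifPn => // /set0P[x Ax].
rewrite mule_ge0//.
  by rewrite lee_fin divr_ge0// ?exprn_ge0// unit_ball_volume_ge0.
apply: expe_ge0; apply: (@le_trans _ _ (enorm (x - x))%:E).
  by rewrite lee_fin sqrtr_ge0.
by apply: ereal_sup_ubound; exists x => //; exists x.
Qed.

Lemma hausdorff_gauge0 : hausdorff_gauge set0 = 0.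
Proof. by rewrite /hausdorff_gauge eqxx. Qed.

Lemma hausdorff0 : hausdorff set0 = 0.
Proof.
have pre0 d : hausdorff_pre d set0 = 0.
  apply: cover_outer0; last exact: hausdorff_gauge_ge0.
    by rewrite /= ediam0 leNye.
  exact: hausdorff_gauge0.
rewrite /hausdorff [X in ereal_sup X](_ : _ = [set 0]) ?ereal_sup1//.
apply/seteqP; split => [_ [d _ <-]|_ ->]; first exact: pre0.
by exists 1%R => //=; exact: ltr01.
Qed.

Lemma hausdorff_pre_le d A : (0 < d)%R -> hausdorff_pre d A <= hausdorff A.
Proof. by move=> d0; apply: ereal_sup_ubound; exists d. Qed.

Lemma hausdorff_ge0 A : 0 <= hausdorff A.
Proof.
apply: le_trans (hausdorff_pre_le A ltr01).
by apply: cover_outer_ge0; exact: hausdorff_gauge_ge0.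
Qed.

Lemma le_hausdorff : {homo hausdorff : A B / A `<=` B >-> A <= B}.
Proof.
move=> A B AB; apply: ge_ereal_sup => _ [d d0 <-].
exact: le_trans (le_cover_outer _ _ AB) (hausdorff_pre_le B d0).
Qed.

Lemma hausdorff_sigma_subadditive : sigma_subadditive hausdorff.
Proof.
move=> F; apply: ge_ereal_sup => _ [d d0 <-].
have := @cover_outer_sigma_subadditive R _ [set A | ediam A <= d%:E] _
  hausdorff_gauge_ge0 F.
move=> /le_trans; apply.
apply: lee_nneseries => [i _ _|i _]; last exact: hausdorff_pre_le.
by apply: cover_outer_ge0; exact: hausdorff_gauge_ge0.
Qed.

HB.instance Definition _ := isOuterMeasure.Build R 'rV[R]_n hausdorff
  hausdorff0 hausdorff_ge0 le_hausdorff hausdorff_sigma_subadditive.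

End hausdorff.

Definition surface_outer (R : realType) (n : nat) :
    {outer_measure set 'rV[R]_n -> \bar R} :=
  @hausdorff R n n.-1.

(* [surface_outer] restricted to its Caratheodory-measurable sets, among which
   are the Borel sets. *)
Definition surface_measure (R : realType) (n : nat) :
    {measure set (caratheodory_type (surface_outer R n)) -> \bar R} :=
  (surface_outer R n :
    set (caratheodory_type (surface_outer R n)) -> \bar R).

Section harmonic.
Context {R : realType} {n : nat}.
Implicit Types (W : set 'rV[R]_n) (u : 'rV[R]_n -> R).

Definition partial (i : 'I_n) u : 'rV[R]_n -> R :=
  fun x => 'D_(delta_mx 0 i) u x.

Definition C1_on W u : Prop :=
  forall x, W x -> {for x, continuous u} /\
  forall i, derivable u x (delta_mx 0 i) /\
            {for x, continuous (partial i u)}.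

Definition C2_on W u : Prop :=
  C1_on W u /\ forall i, C1_on W (partial i u).

Definition laplacian u : 'rV[R]_n -> R :=
  fun x => \sum_(i < n) partial i (partial i u) x.

Definition harmonic_on W u : Prop :=
  C2_on W u /\ forall x, W x -> laplacian u x = 0.

End harmonic.

Section pseudosphere.
Local Open Scope ereal_scope.
Context {R : realType} {n : nat}.
Implicit Types (W : set 'rV[R]_n) (x z a : 'rV[R]_n).

Definition boundary_mean W (u : 'rV[R]_n -> R) : \bar R :=
  ((fine (surface_measure R n (boundary W)))^-1)%:E *
  \int[surface_measure R n]_(x in boundary W) (u x)%:E.

Definition harmonic_pseudosphere W x0 : Prop :=
  forall u : 'rV[R]_n -> R,
    harmonic_on W u -> {within closure W, continuous u} ->
    (u x0)%:E = boundary_mean W u.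

Definition touching_set W x0 : set 'rV[R]_n :=
  [set z | boundary W z /\ enorm (x0 - z) = edist (boundary W) x0].

(* If no point outside [closure W] converges to z, then set0 belongs to the
   filter [within (~` closure W) (nbhs z)] and the inner limit inferior is
   +oo. *)
Definition flatness_index W x0 z : \bar R :=
  (2 / (n%:R * unit_ball_volume R n * enorm (z - x0)))%:E *
  limf_einf (fun r : R =>
    limf_einf (fun a : 'rV[R]_n =>
      \int[surface_measure R n]_(x in boundary W `&` eball z r)
        (dotmul (a - x) (a - x0) / enorm (x - a) ^+ n)%:E)
      (within (~` closure W) (nbhs z)))
    (0%R^'+).

End pseudosphere.

(* Main.v *)
Require Import Defs.
From HB Require Import structures.
From mathcomp Require Import all_boot all_order all_algebra.
From mathcomp Require Import all_classical all_reals all_analysis.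
From mathcomp Require Import measurable_realfun.
From mathcomp Require Import ring lra zify.
(** Write [D] for the boundary of the domain [W], [r] for the distance from
[x0] to [D], [n] for the dimension and [w] for the volume of the unit ball. For
[a] outside the closure of [W] the integrand of the flatness index is half the
sum of a nonnegative function, |x - a|^(2 - n), and of the Poisson-type kernel
P_a(x) = (|a - x0|^2 - |x - x0|^2) / |x - a|^n ([dipoleE]). This kernel is
harmonic away from [a] ([poisson_harmonic]), so the pseudosphere property gives
that its integral over [D] is |D| |a - x0|^(2 - n). Every point of [D] is at
distance at least [r] from [x0], hence on [D], at distance at least [rho] from
[z], the kernel is at most (|a - x0|^2 - r^2) / (rho / 2)^n, which tends to 0
when [a] tends to [z]. What remains of the integral of P_a lives near [z], and
so the inner limit inferior is at least |D| r^(2 - n) / 2 for every [rho]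
([boundary_integral_lower]).

It remains to see that |D| >= n w r^(n - 1) ([area_surrounding]). Every ray from
[x0] meets [D] outside the ball of radius [r]. A covering of [D] by small sets
thus gives, by radial projection, a covering of the shell between the radii
(1 - e) r and r by pieces that are almost cylinders of height e r, whose bases
have at most the diameters of the given sets. With the normalization of
Hausdorff measure, the volume of such a cylinder is controlled by the measure of
the covering set precisely because of the isodiametric inequality in dimension
n - 1 ([isodiametric]): among sets of given diameter the ball has the largest
volume. Comparing volumes and letting e tend to 0 gives the bound.

The isodiametric inequality is proved by Steiner symmetrization along the
coordinate axes. Symmetrization preserves volume and does not increase the
diameter, and a set that is symmetric about the origin lies in the ball whose
diameter is that of the set. To stay within elementary counting, the set is
first replaced by the cubes of a fine grid that meet it ([symmetrization]).

Volumes are those of the outer measure defined by coverings with boxes. Two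
facts about it carry the argument: disjoint boxes inside a set have total volume
at most that of the set ([lebesgue_outer_lower], by integrating one coordinate
at a time), and rotations do not increase volumes ([rotate_to_axis], since plane
rotations are products of shears). The integrals over [D] make sense because
closed sets are measurable for Hausdorff measure ([caratheodory_closed]). *)

Set Implicit Arguments.
Unset Strict Implicit.
Unset Printing Implicit Defensive.
Import Order.TTheory GRing.Theory Num.Theory.
Import numFieldNormedType.Exports.
Local Open Scope classical_set_scope.
Local Open Scope ring_scope.

(** * Euclidean geometry *)

Section euclid.
Context {R : realType} {n : nat}.
Implicit Types (u v w x y a b p : 'rV[R]_n) (c s t : R).

Lemma dotmulC u v : dotmul u v = dotmul v u.
Proof. by apply: eq_bigr => i _; rewrite mulrC. Qed.

Lemma dotmulDl u v w : dotmul (u + v) w = dotmul u w + dotmul v w.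
Proof. by rewrite -big_split; apply: eq_bigr => i _; rewrite mxE mulrDl. Qed.

Lemma dotmulZl c u v : dotmul (c *: u) v = c * dotmul u v.
Proof. by rewrite mulr_sumr; apply: eq_bigr => i _; rewrite mxE mulrA. Qed.

Lemma dotmulDr u v w : dotmul u (v + w) = dotmul u v + dotmul u w.
Proof. by rewrite dotmulC dotmulDl !(dotmulC u). Qed.

Lemma dotmulZr c u v : dotmul u (c *: v) = c * dotmul u v.
Proof. by rewrite dotmulC dotmulZl dotmulC. Qed.

Lemma dotmulNl u v : dotmul (- u) v = - dotmul u v.
Proof. by rewrite -scaleN1r dotmulZl mulN1r. Qed.

Lemma dotmulNr u v : dotmul u (- v) = - dotmul u v.
Proof. by rewrite dotmulC dotmulNl dotmulC. Qed.

Definition dotmulE := (dotmulDl, dotmulDr, dotmulZl, dotmulZr, dotmulNl, dotmulNr).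

Lemma dotmul_ge0 u : 0 <= dotmul u u.
Proof. by apply: sumr_ge0 => i _; rewrite -expr2 sqr_ge0. Qed.

Lemma enorm_ge0 u : 0 <= enorm u. Proof. exact: sqrtr_ge0. Qed.
Hint Resolve enorm_ge0 : core.

Lemma sqr_enorm u : enorm u ^+ 2 = dotmul u u.
Proof. by rewrite sqr_sqrtr// dotmul_ge0. Qed.

Lemma sqr_enormB u v :
  enorm (u - v) ^+ 2 = enorm u ^+ 2 + enorm v ^+ 2 - 2 * dotmul u v.
Proof. by rewrite !sqr_enorm !dotmulE (dotmulC v u); ring. Qed.

Lemma enorm_coord u i : `|u 0 i| <= enorm u.
Proof.
rewrite -sqrtr_sqr ler_wsqrtr// /dotmul (bigD1 i)//= -expr2 lerDl.
by apply: sumr_ge0 => j _; rewrite -expr2 sqr_ge0.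
Qed.

Lemma enorm0P u : (enorm u == 0) = (u == 0).
Proof.
apply/eqP/eqP => [u0|->]; last first.
  by rewrite /enorm /dotmul big1 ?sqrtr0// => i _; rewrite mxE mul0r.
apply/rowP => i; rewrite mxE; apply/eqP.
by rewrite -normr_le0 -u0 enorm_coord.
Qed.

Lemma enorm_gt0 u : (0 < enorm u) = (u != 0).
Proof. by rewrite lt_neqAle eq_sym enorm0P enorm_ge0 andbT. Qed.

Lemma enorm_eq u v : dotmul u u = dotmul v v -> enorm u = enorm v.
Proof. by rewrite /enorm => ->. Qed.

Lemma enorm0 : enorm (0 : 'rV[R]_n) = 0.
Proof. by apply/eqP; rewrite enorm0P. Qed.

Lemma enormN u : enorm (- u) = enorm u.
Proof. by apply: enorm_eq; rewrite !dotmulE opprK. Qed.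

Lemma enormB u v : enorm (u - v) = enorm (v - u).
Proof. by rewrite -enormN opprB. Qed.

Lemma enormZ c u : enorm (c *: u) = `|c| * enorm u.
Proof. by rewrite /enorm !dotmulE mulrA -expr2 sqrtrM ?sqr_ge0// sqrtr_sqr. Qed.

Lemma ler_enorm u v : dotmul u u <= dotmul v v -> enorm u <= enorm v.
Proof. exact: ler_wsqrtr. Qed.

Lemma ler_enormP u c : 0 <= c -> (enorm u <= c) = (dotmul u u <= c ^+ 2).
Proof. by move=> c0; rewrite -sqr_enorm ler_pXn2r ?nnegrE. Qed.

(** Expanding the square of [dotmul v v *: u - dotmul u v *: v]. *)
Lemma dotmul_le u v : dotmul u v <= enorm u * enorm v.
Proof.
have [->|v0] := eqVneq v 0.
  by rewrite enorm0 mulr0 /dotmul big1// => i _; rewrite mxE mulr0.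
have vv : 0 < dotmul v v by rewrite -sqr_enorm exprn_gt0// enorm_gt0.
have := dotmul_ge0 (dotmul v v *: u - dotmul u v *: v).
rewrite !dotmulE (dotmulC v u) => H.
have {}H : 0 <= dotmul v v * (dotmul u u * dotmul v v - dotmul u v ^+ 2).
  apply: le_trans H _; rewrite le_eqVlt; apply/orP; left; apply/eqP; ring.
rewrite pmulr_rge0// subr_ge0 in H.
apply: (le_trans (ler_norm _)); rewrite -ler_sqr ?nnegrE ?mulr_ge0//.
by rewrite real_normK ?num_real// exprMn !sqr_enorm.
Qed.

Lemma ler_enormD u v : enorm (u + v) <= enorm u + enorm v.
Proof.
rewrite ler_enormP ?addr_ge0// !dotmulE (dotmulC v u).
have := dotmul_le u v; rewrite -!sqr_enorm => H; nra.
Qed.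

Lemma ler_enorm_dist u v w : enorm (u - w) <= enorm (u - v) + enorm (v - w).
Proof.
rewrite (_ : u - w = (u - v) + (v - w)) ?ler_enormD//.
by rewrite addrA subrK.
Qed.

Lemma enorm_le_bound u c : (forall i, `|u 0 i| <= c) -> enorm u <= n%:R * c.
Proof.
move=> uc; have [n0|n0] := posnP n.
  rewrite /enorm /dotmul big1 ?sqrtr0 ?n0 ?mul0r// => i.
  by have := ltn_ord i; rewrite [X in (_ < X)%N]n0.
have c0 : 0 <= c by apply: le_trans (uc (Ordinal n0)).
rewrite ler_enormP ?mulr_ge0// exprMn.
apply: (@le_trans _ _ (\sum_(i < n) c ^+ 2)).
  apply: ler_sum => i _; rewrite -expr2 -(real_normK (num_real (u 0 i))).
  by rewrite ler_pXn2r// nnegrE.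
rewrite sumr_const card_ord -[leLHS]mulr_natl ler_wpM2r ?sqr_ge0//.
by rewrite -natrX ler_nat expnS leq_pmulr// expn_gt0 n0.
Qed.

Lemma enorm_le_norm u : enorm u <= n%:R * `|u|.
Proof.
apply: enorm_le_bound => i; rewrite /Num.norm/= mx_normrE.
exact: (le_bigmax _ (fun ij : 'I_1 * 'I_n => `|u ij.1 ij.2|) (0, i)).
Qed.

Lemma norm_le_enorm u : `|u| <= enorm u.
Proof.
rewrite /Num.norm/= mx_normrE; apply/bigmax_leP; split => //= -[i j] _ /=.
by rewrite (ord1 i) enorm_coord.
Qed.

(** After expansion the claim is |a|^2 + |b|^2 >= 2 |a| |b|, combined with
[r ^+ 2 <= enorm a * enorm b]. *)
Lemma radial_contraction a b (r : R) : 0 < r -> r <= enorm a -> r <= enorm b ->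
  enorm ((r / enorm a) *: a - (r / enorm b) *: b) <= enorm (a - b).
Proof.
move=> r0 ra rb; apply: ler_enorm; rewrite !dotmulE (dotmulC b a) -!sqr_enorm.
have := dotmul_le a b; set A := enorm a in ra *; set B := enorm b in rb *.
have A0 : 0 < A by exact: lt_le_trans ra.
have B0 : 0 < B by exact: lt_le_trans rb.
set D := dotmul a b => DAB.
rewrite [leLHS](_ : _ = (r * r) / (A * B) * (2 * (A * B - D))); last first.
  by field; rewrite !gt_eqF.
have rr : (r * r) / (A * B) <= 1.
  by rewrite ler_pdivrMr ?mulr_gt0// mul1r ler_pM// ltW.
apply: (@le_trans _ _ (1 * (2 * (A * B - D)))).
  by apply: ler_wpM2r => //; rewrite mulr_ge0// subr_ge0.
by have := sqr_ge0 (A - B); rewrite expr2 => H; lra.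
Qed.

Lemma cvg_enorm (T : Type) (F : set_system T) {FF : Filter F}
  (f : T -> 'rV[R]_n) l : f x @[x --> F] --> l ->
  enorm (f x) @[x --> F] --> enorm l.
Proof.
move=> fl; apply/cvgrPdist_le => /= e e0.
have e0' : 0 < e / n.+1%:R by rewrite divr_gt0.
move/cvgrPdist_le : fl => /(_ _ e0'); apply: filterS => x /= H.
have K : enorm (l - f x) <= e.
  apply: le_trans (enorm_le_norm _) _.
  apply: (@le_trans _ _ (n.+1%:R * (e / n.+1%:R))).
    by apply: ler_pM => //; rewrite ler_nat.
  by rewrite mulrC divfK.
rewrite ler_norml; apply/andP; split.
  by have := ler_enormD (f x - l) l; rewrite subrK (enormB (f x)); lra.
by have := ler_enormD (l - f x) (f x); rewrite subrK; lra.
Qed.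

Lemma continuous_enormB x0 : continuous (fun y : 'rV[R]_n => enorm (y - x0)).
Proof.
move=> x; apply: (@cvg_enorm _ (nbhs x) _ (fun y : 'rV[R]_n => y - x0)).
by apply: cvgB; [exact: cvg_id|exact: cvg_cst].
Qed.

Lemma open_eball x (r : R) : open (eball x r).
Proof.
rewrite /eball; apply: (@open_comp _ _ (fun y => enorm (y - x)) [set t | t < r]).
  by move=> y _; exact: continuous_enormB.
exact: open_lt.
Qed.

Lemma nbhs_eball x (e : R) : 0 < e -> nbhs x (eball x e).
Proof.
move=> e0; apply: open_nbhs_nbhs; split; first exact: open_eball.
by rewrite /eball/= subrr enorm0.
Qed.

Lemma nbhs_eballP x (A : set 'rV[R]_n) : nbhs x A ->
  exists2 e : R, 0 < e & eball x e `<=` A.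
Proof.
move=> /nbhs_normP[e /= e0 eA]; exists e => // y xy; apply: eA => /=.
by apply: le_lt_trans (norm_le_enorm _) _; rewrite enormB.
Qed.

End euclid.
#[global] Hint Resolve enorm_ge0 : core.

(** * The outer measure of boxes *)

Section box_series.
Local Open Scope ereal_scope.
Context {R : realType}.
Implicit Types (a b : nat -> nat -> R) (c d : nat -> R).

Lemma integral_itv_indic (c a b : R) : (0 <= c)%R -> (a <= b)%R ->
  \int[lebesgue_measure]_t (c * \1_(`]a, b] : set R) t)%:E = (c * (b - a))%:E.
Proof.
move=> c0 ab; under eq_integral do rewrite EFinM.
rewrite ge0_integralZl//=; last first.
  by apply/measurable_EFinP; exact: measurable_indic.
rewrite integral_indic//= setIT lebesgue_measure_itv/= lte_fin.
case: ltP => [_|ba]; first by rewrite -EFinB -EFinM.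
by rewrite (le_anti (introT andP (conj ab ba))) subrr mule0 mulr0.
Qed.

(** Integrating one coordinate at a time turns a pointwise comparison of
step functions into a comparison of total volumes. *)
Lemma le_box_series (m : nat) a b a' b' c d :
    (forall k, 0 <= c k)%R -> (forall k, 0 <= d k)%R ->
    (forall k i, a k i <= b k i)%R -> (forall k i, a' k i <= b' k i)%R ->
    (forall x : nat -> R,
      \sum_(k <oo) (c k * \prod_(i < m) \1_(`]a k i, b k i] : set R) (x i))%:E <=
      \sum_(k <oo) (d k * \prod_(i < m) \1_(`]a' k i, b' k i] : set R) (x i))%:E) ->
  \sum_(k <oo) (c k * \prod_(i < m) (b k i - a k i))%:E <=
  \sum_(k <oo) (d k * \prod_(i < m) (b' k i - a' k i))%:E.
Proof.
elim: m a b a' b' c d => [|m IH] a b a' b' c d c0 d0 ab ab' H.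
  have := H (fun=> 0%R).
  rewrite (eq_eseriesr (g := fun k => (c k * \prod_(i < 0) (b k i - a k i))%:E)).
    rewrite [X in _ <= X -> _](eq_eseriesr
      (g := fun k => (d k * \prod_(i < 0) (b' k i - a' k i))%:E))//.
    by move=> k _; rewrite !big_ord0.
  by move=> k _; rewrite !big_ord0.
have ind0 (A : set R) x : (0 <= \1_A x :> R)%R by rewrite indicE.
have p0 (u v : nat -> nat -> R) k : (forall i, u k i <= v k i)%R ->
    (0 <= \prod_(i < m) (v k i - u k i))%R.
  by move=> uv; apply: prodr_ge0 => i _; rewrite subr_ge0.
pose G (u v : nat -> nat -> R) (e : nat -> R) (t : R) : \bar R :=
  \sum_(k <oo)
    (e k * \1_(`]u k m, v k m] : set R) t * \prod_(i < m) (v k i - u k i))%:E.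
have step (u v : nat -> nat -> R) (e : nat -> R) : (forall k, 0 <= e k)%R ->
    (forall k i, u k i <= v k i)%R ->
    \sum_(k <oo) (e k * \prod_(i < m.+1) (v k i - u k i))%:E =
    \int[lebesgue_measure]_t G u v e t /\
    measurable_fun setT (G u v e).
  move=> e0 uv.
  have M k : measurable_fun setT (fun t =>
      (e k * \1_(`]u k m, v k m] : set R) t * \prod_(i < m) (v k i - u k i))%:E).
    apply/measurable_EFinP; apply: measurable_funM; last exact: measurable_cst.
    by apply: measurable_funM; [exact: measurable_cst|exact: measurable_indic].
  split; last first.
    apply: ge0_emeasurable_sum => // k x _ _.
    by rewrite lee_fin !mulr_ge0// p0.
  rewrite integral_nneseries//; last first.
    by move=> k x _; rewrite lee_fin !mulr_ge0// p0.
  apply: eq_eseriesr => k _.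
  under eq_integral do rewrite mulrAC.
  by rewrite integral_itv_indic ?mulr_ge0 ?p0// big_ord_recr/= mulrA.
have [-> M1] := step a b c c0 ab; have [-> M2] := step a' b' d d0 ab'.
apply: ge0_le_integral => //.
  by move=> t _; apply: nneseries_ge0 => k _ _; rewrite lee_fin !mulr_ge0// p0.
move=> t _; apply: IH => //; try by move=> k; rewrite mulr_ge0.
move=> x; have := H (fun i => if i == m then t else x i).
have E (u v : nat -> nat -> R) (e : nat -> R) k :
    (e k * \prod_(i < m.+1) \1_(`]u k i, v k i] : set R)
      (if i == m :> nat then t else x i) =
    e k * \1_(`]u k m, v k m] : set R) t *
      \prod_(i < m) \1_(`]u k i, v k i] : set R) (x i))%R.
  rewrite big_ord_recr/= eqxx [(_ * \1_ _ t)%R in LHS]mulrC mulrA; congr *%R.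
  by apply: eq_bigr => i _; rewrite ltn_eqF.
rewrite (eq_eseriesr (fun k _ => congr1 EFin (E a b c k))).
by rewrite (eq_eseriesr (fun k _ => congr1 EFin (E a' b' d k))).
Qed.

End box_series.

Section lebesgue.
Context {R : realType} {n' : nat}.
Let n := n'.+1.
Implicit Types (A B : set 'rV[R]_n) (a b v : 'rV[R]_n).

Definition box a b : set 'rV[R]_n := [set x | forall i, a 0 i < x 0 i <= b 0 i].

Definition box_volume a b : R := \prod_(i < n) (b 0 i - a 0 i).

Lemma box_volume_ge0 a b : (forall i, a 0 i <= b 0 i) -> 0 <= box_volume a b.
Proof. by move=> ab; apply: prodr_ge0 => i _; rewrite subr_ge0. Qed.

Lemma box_volume00 : box_volume 0 0 = 0.
Proof. by rewrite /box_volume big_ord_recl !mxE subrr mul0r. Qed.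

(** Covering by arbitrary sets, each charged the volume of the cheapest box
around it, costs the same as covering by boxes; this makes
[lebesgue_outer] an instance of [cover_outer]. *)
Definition box_gauge A : \bar R := ereal_inf [set (box_volume p.1 p.2)%:E |
  p in [set p : 'rV[R]_n * 'rV[R]_n | (forall i, p.1 0 i <= p.2 0 i) /\ A `<=` box p.1 p.2]].

Lemma box_gauge_ge0 A : (0 <= box_gauge A)%E.
Proof.
apply: le_ereal_inf_tmp => _ [p [ple _] <-].
by rewrite lee_fin box_volume_ge0.
Qed.

Lemma box_gauge0 : box_gauge set0 = 0%E.
Proof.
apply/eqP; rewrite eq_le box_gauge_ge0 andbT; apply: ereal_inf_lbound.
by exists (0, 0) => /=; [split => // i; rewrite mxE|rewrite box_volume00].
Qed.

Lemma lebesgue_outerE A : lebesgue_outer A = cover_outer setT box_gauge A.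
Proof.
apply/eqP; rewrite eq_le; apply/andP; split; last first.
  apply: le_ereal_inf_tmp => _ [F [Fle AF] <-].
  apply: (@le_trans _ _ (\sum_(k <oo) box_gauge (box (F k).1 (F k).2))%E).
    by apply: ereal_inf_lbound; exists (fun k => box (F k).1 (F k).2).
  apply: lee_nneseries => [k _ _|k _]; first exact: box_gauge_ge0.
  by apply: ereal_inf_lbound; exists (F k) => //; split; first exact: Fle.
apply: le_ereal_inf_tmp => _ [B [_ AB] <-].
have [[k koo]|] := pselect (exists k, box_gauge (B k) = +oo%E).
  rewrite (eseries_pinfty _ _ koo) ?leey// => i _.
  by rewrite -ltNye (lt_le_trans _ (box_gauge_ge0 _)).
rewrite -forallNE => Boo; apply/lee_addgt0Pr => e e0.
have H k : exists p : 'rV[R]_n * 'rV[R]_n,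
    [/\ forall i, p.1 0 i <= p.2 0 i, B k `<=` box p.1 p.2 &
     ((box_volume p.1 p.2)%:E <= box_gauge (B k) + (e / (2 ^ k.+1)%:R)%:E)%E].
  have e'0 : 0 < e / (2 ^ k.+1)%:R by rewrite divr_gt0// ltr0n expn_gt0.
  have : box_gauge (B k) \is a fin_num.
    by rewrite ge0_fin_numE ?box_gauge_ge0// ltey; apply/eqP; exact: Boo.
  move=> /(lb_ereal_inf_adherent e'0)[_ [p [ple Bp] <-] /ltW pe].
  by exists p; split.
have [F HF] := choice H.
apply: (@le_trans _ _ (\sum_(k <oo) (box_volume (F k).1 (F k).2)%:E)%E).
  apply: ereal_inf_lbound; exists F => //; split; first by move=> k; case: (HF k).
  move=> x /AB[k _ Bx]; exists k => //; have [_ + _] := HF k; exact.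
apply: le_trans (epsilon_trick _ _ (ltW e0)); last by move=> k; exact: box_gauge_ge0.
apply: lee_nneseries => k _; last by have [] := HF k.
by move=> _; rewrite lee_fin box_volume_ge0//; have [] := HF k.
Qed.

Lemma lebesgue_outer0 : lebesgue_outer (set0 : set 'rV[R]_n) = 0%E.
Proof.
by rewrite lebesgue_outerE cover_outer0//; [exact: box_gauge0|exact: box_gauge_ge0].
Qed.

Lemma lebesgue_outer_ge0 A : (0 <= lebesgue_outer A)%E.
Proof. by rewrite lebesgue_outerE; apply: cover_outer_ge0; exact: box_gauge_ge0. Qed.

Lemma le_lebesgue_outer :
  {homo @lebesgue_outer R n : A B / A `<=` B >-> (A <= B)%E}.
Proof. by move=> A B AB; rewrite !lebesgue_outerE; exact: le_cover_outer. Qed.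

Lemma lebesgue_outer_sigma_subadditive : sigma_subadditive (@lebesgue_outer R n).
Proof.
move=> F; rewrite lebesgue_outerE; under eq_eseriesr do rewrite lebesgue_outerE.
exact: (cover_outer_sigma_subadditive _ box_gauge_ge0).
Qed.

HB.instance Definition _ := isOuterMeasure.Build R 'rV[R]_n (@lebesgue_outer R n)
  lebesgue_outer0 lebesgue_outer_ge0 le_lebesgue_outer
  lebesgue_outer_sigma_subadditive.


Lemma lebesgue_outer_box_le a b : (forall i, a 0 i <= b 0 i) ->
  (lebesgue_outer (box a b) <= (box_volume a b)%:E)%E.
Proof.
move=> ab; apply: ereal_inf_lbound.
exists (fun k => if k == 0%N then (a, b) else (0, 0)).
  split; first by case.
  by move=> x abx; exists 0%N.
rewrite (nneseries_split 0 1)/=; last first.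
  by move=> [|k] _; rewrite lee_fin box_volume_ge0.
rewrite big_nat1 eseries0 ?adde0// => -[|k]// _ _.
by rewrite [X in X%:E]box_volume00.
Qed.

Lemma lebesgue_outer_subadditive (I : finType) (F : I -> set 'rV[R]_n) A :
  A `<=` \bigcup_i F i ->
  (lebesgue_outer A <= \sum_i lebesgue_outer (F i))%E.
Proof.
move=> AF; pose G k : set 'rV[R]_n := oapp F set0 (nth None (map Some (enum I)) k).
have GF : (\sum_(i < #|I|) lebesgue_outer (G i) = \sum_i lebesgue_outer (F i))%E.
  rewrite -[RHS]big_enum/= -[RHS](big_map Some xpredT (fun o => lebesgue_outer (oapp F set0 o))).
  by rewrite (big_nth None) size_map -cardE big_mkord.
rewrite -GF; apply: le_trans (outer_measure_subadditive _ _ _).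
apply: le_lebesgue_outer => x /AF[i _ Fix]; rewrite -bigcup_mkord.
have iI : (index i (enum I) < #|I|)%N by rewrite cardE index_mem mem_enum.
exists (index i (enum I)) => //=.
by rewrite /G (nth_map i) -?cardE//= nth_index ?mem_enum.
Qed.

Lemma lebesgue_outerU A B :
  (lebesgue_outer (A `|` B) <= lebesgue_outer A + lebesgue_outer B)%E.
Proof. exact: outer_measureU2. Qed.

End lebesgue.
(** Presents a finite sum as a series, the form in which box coverings are
compared. *)
Lemma nneseries_enum {R : realType} (I : finType) (f : I -> R) :
  (forall i, 0 <= f i) ->
  (\sum_(k <oo) (oapp f 0%R (nth None (map Some (enum I)) k))%:E =
  (\sum_i f i)%R%:E :> \bar R)%E.
Proof.
move=> f0; rewrite (nneseries_split 0 #|I|)/=; last first.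
  by move=> k _; rewrite lee_fin; case: nth.
rewrite eseries0 ?adde0; last first.
  move=> k Ik _; rewrite nth_default// size_map -cardE.
  by rewrite add0n in Ik.
rewrite add0n sumEFin; congr EFin.
rewrite -[RHS]big_enum/= -[RHS](big_map Some xpredT (oapp f 0)).
by rewrite (big_nth None) size_map -cardE.
Qed.

Section lebesgue_lower.
Context {R : realType} {n' : nat}.
Let n := n'.+1.
Implicit Types (A B : set 'rV[R]_n) (a b v x : 'rV[R]_n).

Lemma box_indicE a b x :
  \prod_(i < n) \1_(`]a 0 i, b 0 i] : set R) (x 0 i) = \1_(box a b) x :> R.
Proof.
rewrite indicE; have [/set_mem xab|xab] := boolP (x \in box a b).
  rewrite big1// => i _; rewrite indicE mem_set//=.
  by rewrite in_itv/= xab.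
have [i xi] : exists i, ~ (a 0 i < x 0 i <= b 0 i).
  by apply/existsNP => H; case/negP: xab; exact/mem_set.
by rewrite (bigD1 i)//= indicE memNset ?mul0r//= in_itv/=.
Qed.

(** Disjointness bounds the sum of the indicators of the inner boxes by 1, hence
by the sum of the indicators of any covering boxes. *)
Lemma lebesgue_outer_lower (I : finType) (a b : I -> 'rV[R]_n) A :
  (forall j i, a j 0 i <= b j 0 i) ->
  (forall j, box (a j) (b j) `<=` A) ->
  (forall j j' x, box (a j) (b j) x -> box (a j') (b j') x -> j = j') ->
  ((\sum_j box_volume (a j) (b j))%:E <= lebesgue_outer A)%E.
Proof.
move=> ab abA abI; apply: le_ereal_inf_tmp => _ [F [Fle AF] <-].
pose e k := nth None (map Some (enum I)) k.
pose ea k i := oapp (fun j => a j 0 (inord i : 'I_n)) 0 (e k).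
pose eb k i := oapp (fun j => b j 0 (inord i : 'I_n)) 0 (e k).
pose c k : R := oapp (fun=> 1) 0 (e k).
rewrite [leRHS](eq_eseriesr (g := fun k =>
    (1 * \prod_(i < n) ((F k).2 0 (inord i) - (F k).1 0 (inord i)))%:E)); last first.
  by move=> k _; rewrite mul1r; congr EFin; apply: eq_bigr => i _; rewrite inord_val.
have := @le_box_series R n ea eb (fun k i => (F k).1 0 (inord i))
  (fun k i => (F k).2 0 (inord i)) c (fun=> 1).
have -> : (\sum_(k <oo) (c k * \prod_(i < n) (eb k i - ea k i))%:E =
  (\sum_j box_volume (a j) (b j))%:E)%E.
  rewrite -nneseries_enum; last by move=> j; exact: box_volume_ge0.
  apply: eq_eseriesr => k _; congr EFin.
  rewrite /c /eb /ea /e; case: nth => [j|]/=; last by rewrite mul0r.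
  by rewrite mul1r; apply: eq_bigr => i _; rewrite inord_val.
apply => //.
- by move=> k; rewrite /c; case: (e k) => //=.
- by move=> k i; rewrite /ea /eb; case: (e k) => //=.
move=> x; pose v : 'rV[R]_n := \row_i x i.
have xv (i : 'I_n) : x i = v 0 i by rewrite mxE.
have ER k : 1 * \prod_(i < n) \1_(`](F k).1 0 (inord i), (F k).2 0 (inord i)] : set R) (x i) = \1_(box (F k).1 (F k).2) v :> R.
  by rewrite mul1r -box_indicE; apply: eq_bigr => i _; rewrite inord_val xv.
rewrite [leRHS](eq_eseriesr (fun k _ => congr1 EFin (ER k))).
have EL k : c k * \prod_(i < n) \1_(`]ea k i, eb k i] : set R) (x i) =
   oapp (fun j => \1_(box (a j) (b j)) v) 0 (e k) :> R.
  rewrite /c /eb /ea; case: (e k) => [j|]/=; last by rewrite mul0r.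
  by rewrite mul1r -box_indicE; apply: eq_bigr => i _; rewrite inord_val xv.
rewrite [leLHS](eq_eseriesr (fun k _ => congr1 EFin (EL k))).
rewrite nneseries_enum; last by move=> j; rewrite indicE.
have F0 k : (0 <= (\1_(box (F k).1 (F k).2) v)%:E :> \bar R)%E.
  by rewrite lee_fin indicE.
have [[j jv]|Nv] := pselect (exists j, box (a j) (b j) v); last first.
  rewrite big1 ?nneseries_ge0// => j _.
  by rewrite indicE memNset// => jv; apply: Nv; exists j.
have [k _ Fkv] := AF _ (abA _ _ jv).
apply: (@le_trans _ _ (\1_(box (F k).1 (F k).2) v)%:E); last first.
  rewrite (nneseries_split 0 k.+1)// add0n big_nat_recr//=.
  rewrite [X in (_ <= X + _)%E]addeC -addeA leeDl//.
  by rewrite adde_ge0 ?nneseries_ge0// sume_ge0.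
rewrite indicE mem_set// lee_fin (bigD1 j)//= indicE mem_set//.
rewrite big1 ?addr0// => j' jj'; rewrite indicE memNset// => j'v.
by case/eqP: jj'; exact: abI jv.
Qed.

End lebesgue_lower.
(** Similarities, shears and products with an interval all act on outer measure
as preimages, so that it is enough to check each of them on boxes. *)
Lemma lebesgue_outer_preimage {R : realType} (m n : nat)
    (psi : 'rV[R]_m.+1 -> 'rV[R]_n.+1) (D : set 'rV[R]_m.+1) (K : R) :
    0 < K ->
    (forall a b : 'rV[R]_n.+1, (forall i, a 0 i <= b 0 i) ->
      (lebesgue_outer (psi @^-1` box a b `&` D) <= (K * box_volume a b)%:E)%E) ->
  forall A, (lebesgue_outer (psi @^-1` A `&` D) <= K%:E * lebesgue_outer A)%E.
Proof.
move=> K0 HK A; rewrite -lee_pdivrMl//.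
apply: le_ereal_inf_tmp => _ [F [Fle AF] <-]; rewrite lee_pdivrMl//.
apply: (@le_trans _ _ (\sum_(k <oo)
    lebesgue_outer (psi @^-1` box (F k).1 (F k).2 `&` D))%E).
  apply: le_trans (lebesgue_outer_sigma_subadditive _).
  apply: le_lebesgue_outer => y [/AF[k _ Fk] Dy]; exists k => //; split => //.
rewrite -nneseriesZl; last first.
  by move=> k _; rewrite lee_fin; exact: (box_volume_ge0 (Fle k)).
apply: lee_nneseries => [k _ _|k _]; first exact: lebesgue_outer_ge0.
by rewrite -EFinM; exact: HK (Fle k).
Qed.

Section similarity.
Context {R : realType} {n' : nat}.
Let n := n'.+1.
Implicit Types (A B : set 'rV[R]_n) (a b v x : 'rV[R]_n).

Lemma lebesgue_outer_shift v A :
  (lebesgue_outer [set y | A (y + v)%R] <= lebesgue_outer A)%E.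
Proof.
have := @lebesgue_outer_preimage R n' n' (fun y => y + v) setT 1 ltr01.
move=> /(_ _ A); rewrite mul1e setIT; apply => a b ab; rewrite mul1r setIT.
have -> : (fun y => y + v) @^-1` box a b = box (a - v) (b - v).
  by apply/seteqP; split => y /= H i; have := H i; rewrite !mxE ltrBlDr lerBrDr.
apply: le_trans (lebesgue_outer_box_le _) _.
  by move=> i; rewrite !mxE lerD2r.
rewrite lee_fin le_eqVlt; apply/orP; left; apply/eqP; apply: eq_bigr => i _.
by rewrite !mxE; ring.
Qed.

Lemma lebesgue_outer_scale (c : R) A : 0 < c ->
  (lebesgue_outer [set y | A (c *: y)%R] <= (c^-1 ^+ n)%:E * lebesgue_outer A)%E.
Proof.
move=> c0; have K0 : 0 < c^-1 ^+ n by rewrite exprn_gt0// invr_gt0.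
have := @lebesgue_outer_preimage R n' n' (fun y => c *: y) setT _ K0.
move=> /(_ _ A); rewrite setIT; apply => a b ab; rewrite setIT.
have -> : (fun y => c *: y) @^-1` box a b = box (c^-1 *: a) (c^-1 *: b).
  apply/seteqP; split => y /= H i; have := H i; rewrite !mxE.
    by rewrite ltr_pdivrMl// ler_pdivlMl.
  by rewrite ltr_pdivrMl// ler_pdivlMl.
apply: le_trans (lebesgue_outer_box_le _) _.
  by move=> i; rewrite !mxE ler_pM2l// invr_gt0.
rewrite lee_fin le_eqVlt; apply/orP; left; apply/eqP.
rewrite /box_volume -[n in c^-1 ^+ n]card_ord -prodr_const -big_split/=.
by apply: eq_bigr => i _; rewrite !mxE; ring.
Qed.

Lemma lebesgue_outer_cylinder (c h : R) A : 0 < h ->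
  (lebesgue_outer [set y : 'rV[R]_n.+1 | (A (\row_i y 0 (lift ord0 i)) /\
     c < y 0 ord0 <= c + h)%R] <= h%:E * lebesgue_outer A)%E.
Proof.
move=> h0; have := @lebesgue_outer_preimage R n n' (fun y => \row_i y 0 (lift ord0 i))
  [set y | (c < y 0 ord0 <= c + h)%R] h h0.
move=> /(_ _ A); apply => a b ab.
pose ext (v : 'rV[R]_n) (t : R) : 'rV[R]_n.+1 := \row_i oapp (fun j => v 0 j) t (unlift ord0 i).
have ext0 v t : ext v t 0 ord0 = t by rewrite mxE unlift_none.
have extS v t i : ext v t 0 (lift ord0 i) = v 0 i by rewrite mxE liftK.
set S := (X in lebesgue_outer X).
have SB : S `<=` box (ext a c) (ext b (c + h)).
  move=> y [/= H1 H2] i; case: (unliftP ord0 i) => [j|] ->.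
    by have := H1 j; rewrite !extS mxE.
  by rewrite !ext0.
apply: le_trans (le_lebesgue_outer SB) _.
apply: le_trans (lebesgue_outer_box_le _) _.
  move=> i; case: (unliftP ord0 i) => [j|] ->; first by rewrite !extS.
  by rewrite !ext0 lerDl ltW.
rewrite lee_fin /box_volume big_ord_recl !ext0 addrAC subrr add0r.
by under eq_bigr do rewrite !extS.
Qed.

End similarity.

Lemma ceil_ord {R : realType} (q : R) (M : nat) : 0 < q -> q <= M%:R ->
  exists j : 'I_M, j%:R < q <= j%:R + 1.
Proof.
move=> q0 qM; have [|k kq kmin] := @ex_minnP (fun k : nat => q <= k%:R).
  by exists M.
have k0 : (0 < k)%N by rewrite lt0n; apply: contraTneq kq => ->; rewrite -ltNge.
have kM : (k.-1 < M)%N by rewrite prednK// kmin.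
exists (Ordinal kM) => /=; apply/andP; split; last by rewrite natr1 prednK.
by rewrite ltNge; apply/negP => /kmin; rewrite -{1}(prednK k0) ltnn.
Qed.

Section shear.
Context {R : realType} {n' : nat}.
Let n := n'.+1.
Implicit Types (A B : set 'rV[R]_n) (a b v x : 'rV[R]_n) (i j : 'I_n).

Definition shear i j (t : R) x : 'rV[R]_n :=
  \row_k (x 0 k + if k == i then t * x 0 j else 0).

(** Cut into [N] slabs across coordinate [j], each sheared box fits
into a slightly wider box. *)
Lemma lebesgue_outer_shear_box i j t a b (N : nat) : i != j ->
  (forall i, a 0 i <= b 0 i) ->
  (lebesgue_outer (shear i j t @^-1` box a b) <=
   (box_volume a b + N.+1%:R^-1 *
     (`|t| * (b 0 j - a 0 j) ^+ 2 *
       \prod_(k | (k != i) && (k != j)) (b 0 k - a 0 k)))%:E)%E.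
Proof.
move=> ij ab; set w := b 0 j - a 0 j; have w0 : 0 <= w by rewrite subr_ge0.
pose d := w / N.+1%:R; have d0 : 0 <= d by rewrite divr_ge0.
have dw : N.+1%:R * d = w by rewrite mulrC divfK.
(* the extreme values of [t * y] over the slab [p + [0, d]] *)
pose lo p := Num.max (t * p) (t * (p + d)); pose hi p := Num.min (t * p) (t * (p + d)).
pose p (s : 'I_N.+1) := a 0 j + s%:R * d.
pose a' s : 'rV[R]_n := \row_k (if k == j then p s else if k == i then a 0 i - lo (p s) else a 0 k).
pose b' s : 'rV[R]_n := \row_k (if k == j then p s + d else if k == i then b 0 i - hi (p s) else b 0 k).
have ji : (j == i) = false by rewrite eq_sym (negbTE ij).
have lohi s : lo (p s) - hi (p s) = `|t| * d.
  rewrite /lo /hi; have [t0|t0] := lerP 0 t.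
    have H : t * p s <= t * (p s + d) by rewrite ler_wpM2l// lerDl.
    by rewrite (max_r H) (min_l H) ger0_norm//; ring.
  have H : t * (p s + d) <= t * p s by rewrite (ler_wnM2l (ltW t0))// lerDl.
  by rewrite (max_l H) (min_r H) ltr0_norm//; ring.
have bounds s y : p s < y <= p s + d -> hi (p s) <= t * y <= lo (p s).
  move=> /andP[/ltW y1 y2]; rewrite /lo /hi le_max ge_min.
  have [t0|/ltW t0] := lerP 0 t.
    by rewrite (ler_wpM2l t0 y1) (ler_wpM2l t0 y2) orbT.
  by rewrite (ler_wnM2l t0 y1) (ler_wnM2l t0 y2) orbT.
have ab' s k : a' s 0 k <= b' s 0 k.
  rewrite !mxE; case: eqP => _; first by rewrite lerDl.
  case: eqP => _ //; have := lohi s; have := ab i.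
  by have := mulr_ge0 (normr_ge0 t) d0; lra.
apply: le_trans (@lebesgue_outer_subadditive R n' _ (fun s => box (a' s) (b' s)) _ _) _.
  move=> y /= Hy.
  have yj : a 0 j < y 0 j <= b 0 j by have := Hy j; rewrite mxE ji addr0.
  have [d00|dn0] := eqVneq d 0.
    by move: yj dw; rewrite d00 mulr0 /w; lra.
  have dp : 0 < d by rewrite lt_neqAle eq_sym dn0.
  have [s Hs] : exists s : 'I_N.+1, p s < y 0 j <= p s + d.
    pose q := (y 0 j - a 0 j) / d.
    have q0 : 0 < q by rewrite divr_gt0// subr_gt0; case/andP: yj.
    have qN : q <= N.+1%:R by rewrite ler_pdivrMr// dw lerD2r; case/andP: yj.
    have yq : y 0 j = a 0 j + q * d by rewrite /q divfK// addrC subrK.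
    have [k /andP[q1 q2]] := ceil_ord q0 qN; exists k; rewrite /p.
    by clearbody q; rewrite yq; apply/andP; split; nra.
  exists s => // k; rewrite !mxE; case: eqP => [->//|_].
  have := Hy k; rewrite mxE; case: eqP => [->|_]; last by rewrite addr0.
  have := bounds _ _ Hs; lra.
apply: (@le_trans _ _ (\sum_(s < N.+1) (box_volume (a' s) (b' s))%:E)%E).
  by apply: lee_sum => s _; exact: lebesgue_outer_box_le.
rewrite sumEFin lee_fin.
set P := \prod_(k | _) _.
have V s : box_volume (a' s) (b' s) = d * ((b 0 i - a 0 i + `|t| * d) * P).
  rewrite /box_volume (bigD1 j)//= (bigD1 i)//= !mxE eqxx (negbTE ij) eqxx.
  congr (_ * (_ * _)); first by ring.
    by rewrite -(lohi s); ring.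
  apply: eq_big => [k|k /andP[kj ki]]; first by rewrite andbC.
  by rewrite !mxE (negbTE kj) (negbTE ki).
under eq_bigr do rewrite V.
rewrite [leLHS](_ : _ = w * ((b 0 i - a 0 i + `|t| * d) * P)); last first.
  by rewrite sumr_const card_ord -dw -[LHS]mulr_natl -mulrA.
rewrite /box_volume.
rewrite [in leRHS](bigD1 j)//= [in leRHS](bigD1 i)//=.
rewrite [X in _ <= _ * (_ * X) + _](_ : _ = P); last first.
  by apply: eq_bigl => k; rewrite andbC.
by rewrite /d le_eqVlt; apply/orP; left; apply/eqP; rewrite -/w; field.
Qed.

(** The error term of the slabs is of order [N.+1%:R^-1]. *)
Lemma lebesgue_outer_shear i j t A : i != j ->
  (lebesgue_outer (shear i j t @^-1` A) <= lebesgue_outer A)%E.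
Proof.
move=> ij; have := @lebesgue_outer_preimage R n' n' (shear i j t) setT 1 ltr01.
move=> /(_ _ A); rewrite mul1e setIT; apply => a b ab; rewrite mul1r setIT.
set C := (`|t| * (b 0 j - a 0 j) ^+ 2 *
   \prod_(k | (k != i) && (k != j)) (b 0 k - a 0 k)).
apply/lee_addgt0Pr => e e0.
have C0 : 0 <= C.
  apply: mulr_ge0; first by rewrite mulr_ge0// sqr_ge0.
  by apply: prodr_ge0 => k _; rewrite subr_ge0.
pose N := Num.trunc (C / e).
apply: le_trans (lebesgue_outer_shear_box t N ij ab) _.
rewrite -EFinD lee_fin lerD2l -/C ler_pdivrMl// -ler_pdivrMr//.
by apply/ltW; have := truncnS_gt (C / e).
Qed.

End shear.
(** * Balls and rotations *)

Section ball_volume.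
Context {R : realType} {n' : nat}.
Let n := n'.+1.
Implicit Types (A B : set 'rV[R]_n) (a b v x : 'rV[R]_n).

(** Taking [fine] loses nothing, since the ball lies in a cube. *)
Lemma unit_ball_volumeE :
  lebesgue_outer (eball (0 : 'rV[R]_n) 1) = (unit_ball_volume R n)%:E.
Proof.
rewrite /unit_ball_volume fineK// ge0_fin_numE ?lebesgue_outer_ge0//.
have sub : eball 0 1 `<=` box (const_mx (-1)) (const_mx 1 : 'rV[R]_n).
  move=> x; rewrite /eball/= subr0 => x1 i; rewrite !mxE.
  by have := le_lt_trans (enorm_coord x i) x1; rewrite ltr_norml => /andP[-> /ltW].
apply: le_lt_trans (le_lebesgue_outer sub) _.
apply: le_lt_trans (lebesgue_outer_box_le _) _; last by rewrite ltey.
by move=> i; rewrite !mxE; lra.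
Qed.

(** The ball contains the cube of side [n.+1%:R^-1]. *)
Lemma unit_ball_volume_gt0 : 0 < unit_ball_volume R n.
Proof.
rewrite -lte_fin -unit_ball_volumeE.
pose e : R := n.+1%:R^-1.
have e0 : 0 < e by rewrite invr_gt0.
have := @lebesgue_outer_lower R n' 'I_1 (fun=> 0) (fun=> const_mx e) (eball 0 1).
have V : (0 < (\sum_(j < 1) box_volume 0 (const_mx e : 'rV[R]_n))%:E :> \bar R)%E.
  rewrite big_ord1 lte_fin; apply: prodr_gt0 => i _; rewrite !mxE subr0.
  exact: e0.
move=> H; apply: (lt_le_trans V); apply: H => [_ i|_ x /= Hx|j j' _ _ _].
- by rewrite !mxE ltW.
- rewrite /eball/= subr0; apply: (@le_lt_trans _ _ (n%:R * e)).
    apply: enorm_le_bound => i; have := Hx i; rewrite !mxE => /andP[x0 xe].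
    by rewrite gtr0_norm.
  by rewrite ltr_pdivrMr// mul1r ltr_nat.
- by rewrite !ord1.
Qed.

Lemma lebesgue_outer_eball x (r : R) : 0 < r ->
  lebesgue_outer (eball x r) = (unit_ball_volume R n * r ^+ n)%:E.
Proof.
move=> r0; apply/eqP; rewrite eq_le; apply/andP; split.
  apply: (@le_trans _ _ (lebesgue_outer (eball (0 : 'rV[R]_n) r))).
    apply: le_trans (lebesgue_outer_shift (- x) _).
    by apply: le_lebesgue_outer => y; rewrite /eball/= subr0.
  have := @lebesgue_outer_scale R n' r^-1 (eball 0 1).
  rewrite invr_gt0 invrK unit_ball_volumeE -EFinM mulrC => /(_ r0).
  apply: le_trans; apply: le_lebesgue_outer => y; rewrite /eball/= !subr0.
  by rewrite enormZ gtr0_norm ?invr_gt0// ltr_pdivrMl// mulr1.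
rewrite EFinM muleC -lee_pdivlMl ?exprn_gt0// -unit_ball_volumeE -exprVn.
apply: (@le_trans _ _ (lebesgue_outer [set y | (eball 0 r) (r *: y)%R])).
  apply: le_lebesgue_outer => y; rewrite /eball/= !subr0.
  by rewrite enormZ gtr0_norm// -ltr_pdivlMl// mulVf// gt_eqF.
apply: le_trans (lebesgue_outer_scale _ r0) _.
rewrite lee_pmul2l//; last by rewrite lte_fin exprn_gt0// invr_gt0.
apply: le_trans (lebesgue_outer_shift x _).
by apply: le_lebesgue_outer => y; rewrite /eball/= subr0 addrK.
Qed.

End ball_volume.

Section rotation.
Context {R : realType} {n' : nat}.
Let n := n'.+1.
Implicit Types (A B : set 'rV[R]_n) (u v x : 'rV[R]_n) (Q : 'rV[R]_n -> 'rV[R]_n).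

(** Only one inequality is asked of volumes: it is stable under composition, and
in the form of preimages it bounds the volume of [A] by that of [Q @` A]. *)
Definition volume_isometry Q : Prop :=
  [/\ forall u v, Q (u - v) = Q u - Q v,
      forall u, enorm (Q u) = enorm u &
      forall A, (lebesgue_outer (Q @^-1` A) <= lebesgue_outer A)%E].

Lemma volume_isometry_comp Q Q' :
  volume_isometry Q -> volume_isometry Q' -> volume_isometry (Q' \o Q).
Proof.
move=> [QB Qn QA] [Q'B Q'n Q'A]; split=> [u v|u|A] /=.
- by rewrite QB Q'B.
- by rewrite Q'n Qn.
- by rewrite comp_preimage; apply: le_trans (QA _) (Q'A _).
Qed.

(** Polarization. *)
Lemma volume_isometry_dotmul Q u v : volume_isometry Q ->
  dotmul (Q u) (Q v) = dotmul u v.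
Proof.
move=> [QB Qn _]; have := sqr_enorm (Q (u - v)); have := sqr_enorm (u - v).
rewrite Qn => ->; rewrite QB !dotmulE !opprK -!sqr_enorm !Qn.
by rewrite (dotmulC v) (dotmulC (Q v)); lra.
Qed.

(** A rotation of a coordinate plane is a product of three shears, which is
why it does not increase volumes. *)
Definition givens (j : 'I_n) (c s : R) : 'rV[R]_n -> 'rV[R]_n :=
  shear ord0 j (s / (1 + c)) \o (shear j ord0 (- s) \o shear ord0 j (s / (1 + c))).

Lemma givensE j c s u : j != ord0 -> -1 < c -> c ^+ 2 + s ^+ 2 = 1 ->
  [/\ givens j c s u 0 ord0 = c * u 0 ord0 + s * u 0 j,
      givens j c s u 0 j = - s * u 0 ord0 + c * u 0 j &
      forall k, k != ord0 -> k != j -> givens j c s u 0 k = u 0 k].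
Proof.
move=> j0 c1 cs; have c1' : 1 + c != 0 by rewrite gt_eqF//; lra.
have j0' : (ord0 == j) = false by rewrite eq_sym (negbTE j0).
have s2 : s ^+ 2 = (1 + c) * (1 - c) by rewrite -[s ^+ 2](addKr (c ^+ 2)) cs; ring.
have st : s * (s / (1 + c)) = 1 - c by rewrite mulrA -expr2 s2 mulrC mulKf.
split.
- rewrite !(mxE, eqxx, negbTE j0, j0') !addr0.
  set t := s / (1 + c) in st *; have ts : t * (1 + c) = s by rewrite /t divfK.
  transitivity ((1 - s * t) * u 0 ord0 + (t * (1 + (1 - s * t))) * u 0 j); first by ring.
  by rewrite st -[in RHS]ts; ring.
- rewrite !(mxE, eqxx, negbTE j0, j0') !addr0.
  set t := s / (1 + c) in st *.
  transitivity (- s * u 0 ord0 + (1 - s * t) * u 0 j); first by ring.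
  by rewrite st; ring.
- move=> k k0 kj.
  by rewrite !(mxE, negbTE k0, negbTE kj) !addr0.
Qed.

Lemma givens_isometry j c s : j != ord0 -> -1 < c -> c ^+ 2 + s ^+ 2 = 1 ->
  volume_isometry (givens j c s).
Proof.
move=> j0 c1 cs; have j0' : (ord0 == j) = false by rewrite eq_sym (negbTE j0).
split=> [u v|u|A].
- apply/rowP => k.
  have shearB i i' t x y : shear i i' t (x - y) = shear i i' t x - shear i i' t y.
    by apply/rowP => l; rewrite !mxE; case: ifP => _; ring.
  by rewrite /givens/= !shearB.
- apply: enorm_eq; have [g0 gj gk] := givensE u j0 c1 cs.
  rewrite /dotmul (bigD1 ord0)//= (bigD1 j)//= [in RHS](bigD1 ord0)//= [in RHS](bigD1 j)//=.
  rewrite g0 gj !addrA; congr (_ + _); last first.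
    by apply: eq_bigr => k /andP[k0 kj]; rewrite gk.
  transitivity ((c ^+ 2 + s ^+ 2) * (u 0 ord0 * u 0 ord0 + u 0 j * u 0 j)); first by ring.
  by rewrite cs mul1r.
- have j0'' : ord0 != j by rewrite eq_sym.
  pose t := s / (1 + c); pose B := shear ord0 j t @^-1` A.
  have HC := lebesgue_outer_shear t (shear j ord0 (- s) @^-1` B) j0''.
  have HB := lebesgue_outer_shear (- s) B j0.
  exact: (le_trans HC (le_trans HB (lebesgue_outer_shear t A j0''))).
Qed.

(** Rotations in the planes spanned by the first axis and each other axis kill
the coordinates of [u] one after the other. *)
Lemma rotate_to_axis u : exists Q, volume_isometry Q /\
  forall i, i != ord0 -> Q u 0 i = 0.
Proof.
suff H k : (k <= n)%N -> exists Q, volume_isometry Q /\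
    forall i : 'I_n, i != ord0 -> (i < k)%N -> Q u 0 i = 0.
  have [Q [vQ Q0]] := H n (leqnn _); exists Q; split => // i i0; exact: Q0.
elim: k => [_|k IH kn].
  by exists id; split => //; split.
have [Q [vQ Q0]] := IH (ltnW kn); pose j := Ordinal kn.
have step (i : 'I_n) : (i < k.+1)%N -> i = j \/ (i < k)%N.
  rewrite ltnS leq_eqVlt => /orP[/eqP ik|]; [left|by right].
  exact/val_inj.
have [j0|j0] := eqVneq j ord0.
  exists Q; split => // i i0 /step[ij|/Q0]; last exact.
  by rewrite ij j0 eqxx in i0.
(* a half turn, [c = -1], is not a product of these three shears, so a zero
   coordinate is treated apart *)
have [b0|b0] := eqVneq (Q u 0 j) 0.
  by exists Q; split => // i i0 /step[->|/Q0]//; exact.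
set a := Q u 0 ord0; set b := Q u 0 j in b0.
pose rho := Num.sqrt (a ^+ 2 + b ^+ 2).
have ab0 : 0 < a ^+ 2 + b ^+ 2 by rewrite ltr_wpDl ?sqr_ge0// exprn_even_gt0.
have rho0 : 0 < rho by rewrite sqrtr_gt0.
have rho2 : rho ^+ 2 = a ^+ 2 + b ^+ 2 by rewrite sqr_sqrtr// ltW.
have arho : - rho < a.
  have : `|a| < rho.
    rewrite -sqrtr_sqr ltr_sqrt// ltrDl exprn_even_gt0//.
  by rewrite ltr_norml => /andP[].
have c1 : -1 < a / rho by rewrite ltr_pdivlMr// mulN1r.
have cs : (a / rho) ^+ 2 + (b / rho) ^+ 2 = 1.
  by rewrite !expr_div_n -mulrDl -rho2 divff// gt_eqF// exprn_gt0.
exists (givens j (a / rho) (b / rho) \o Q); split.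
  apply: volume_isometry_comp => //; exact: givens_isometry.
have [_ gj gk] := givensE (Q u) j0 c1 cs.
move=> i i0 ik /=; have [->|ij] := eqVneq i j.
  by rewrite gj -/a -/b; ring.
rewrite gk//; case: (step i ik) => [/eqP|ik']; first by rewrite (negbTE ij).
exact: Q0.
Qed.

End rotation.

(** * Discrete Steiner symmetrization *)

Section steiner.
Local Close Scope classical_set_scope.
Local Close Scope ring_scope.
Local Open Scope nat_scope.
Context {m' N : nat}.
Let m := m'.+1.
Let G := N.*2.+1.
Let T := {ffun 'I_m -> 'I_G}.
Implicit Types (A B : {set T}) (x y : T) (i : 'I_m) (s t : 'I_G).

Definition upd x i t : T := [ffun k => if k == i then t else x k].

Definition column i A x : {set 'I_G} := [set t | upd x i t \in A].

Definition offset (t : nat) : nat := (t - N) + (N - t).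

(** Each column parallel to axis [i] is replaced by a centred run of
consecutive points. A column of even size loses one point, so that the result
is exactly symmetric and still lies on the grid. *)
Definition steiner i A : {set T} :=
  [set x : T | 2 * offset (x i) < #|column i A x|].

Definition sqdist x y : nat := \sum_i ((x i - y i) + (y i - x i)) ^ 2.

Lemma upd_same x i : upd x i (x i) = x.
Proof. by apply/ffunP => k; rewrite ffunE; case: eqP => [->|]. Qed.

Lemma upd_upd x i s t : upd (upd x i s) i t = upd x i t.
Proof. by apply/ffunP => k; rewrite !ffunE; case: eqP. Qed.

Lemma column_upd i A x t : column i A (upd x i t) = column i A x.
Proof. by apply/setP => s; rewrite !inE upd_upd. Qed.

Lemma column_steiner i A x :
  column i (steiner i A) x = [set t : 'I_G | 2 * offset t < #|column i A x|].
Proof. by apply/setP => t; rewrite !inE column_upd ffunE eqxx. Qed.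

(** The centred run has [k] points for odd [k], and [k.-1] for even [k]. *)
Lemma card_centred k : k <= G -> k <= #|[set t : 'I_G | 2 * offset t < k]| + 1.
Proof.
move=> kG; have [->//|k0] := posnP k.
pose q := k.-1./2; have qk : k <= q.*2 + 2 /\ q.*2 < k by rewrite /q; lia.
have NG (j : 'I_(q.*2.+1)) : N - q + j < G by have := ltn_ord j; rewrite /G in kG *; lia.
pose f j := Ordinal (NG j).
have finj : injective f by move=> j j' [] /eqP; rewrite eqn_add2l => /eqP/val_inj.
apply: (@leq_trans (q.*2.+1 + 1)); first by lia.
rewrite leq_add2r -[X in X <= _]card_ord -cardsT -(card_imset _ finj).
apply/subset_leq_card/fintype.subsetP => _ /imsetP[j _ ->]; rewrite inE /offset/=.
by have := ltn_ord j; rewrite /G in kG; lia.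
Qed.

(** Both sides count the pairs [(x, t)] with [upd x i t] in [A]; exchanging
[x i] and [t] is an involution on such pairs. *)
Lemma sum_card_column i A : \sum_(x : T) #|column i A x| = G * #|A|.
Proof.
under eq_bigr do rewrite -sum1_card big_mkcond.
rewrite pair_bigA/=.
pose f (p : T * 'I_G) := (upd p.1 i p.2, p.1 i).
have fK : involutive f.
  by move=> [x t]; rewrite /f/= upd_upd upd_same ffunE eqxx.
rewrite (reindex_inj (inv_inj fK))/=.
under eq_bigr do rewrite inE upd_upd upd_same.
rewrite -(pair_bigA _ (fun x _ => if x \in A then 1 else 0))/=.
under eq_bigr do rewrite sum_nat_const card_ord.
rewrite -big_distrr/=; congr (_ * _).
by rewrite -big_mkcond sum1_card.
Qed.

(** A column loses at most one point, and there are [G ^ m'] columns. *)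
Lemma card_steiner i A : #|A| <= #|steiner i A| + G ^ m'.
Proof.
have G0 : 0 < G by [].
rewrite -(leq_pmul2l G0) mulnDr -!(sum_card_column i) -expnS.
have -> : G ^ m'.+1 = \sum_(x : T) 1 by rewrite sum1_card card_ffun !card_ord.
rewrite -big_split/=; apply: leq_sum => x _.
rewrite column_steiner; apply: card_centred.
by rewrite -[X in _ <= X]card_ord max_card.
Qed.

(** The extreme points of [F] work. *)
Lemma card_spread (F : {set 'I_G}) k : k < #|F| ->
  exists s t, [/\ s \in F, t \in F & s + k <= t].
Proof.
move=> kF; have /card_gt0P[s0 s0F] : 0 < #|F| by lia.
have [s sF smin] := arg_minnP (fun s : 'I_G => val s) s0F.
have [t tF tmax] := arg_maxnP (fun s : 'I_G => val s) s0F.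
exists s, t; split => //; rewrite leqNgt; apply/negP => tsk.
have : #|F| <= #|'I_k|.
  have st (u : 'I_G) : u \in F -> u - s < k.
    by move=> uF; have := smin _ uF; have := tmax _ uF; rewrite /=; lia.
  case: k => [|k] in kF tsk st *; first by have := st _ s0F; rewrite ltn0.
  pose f (u : 'I_G) : 'I_k.+1 := inord (u - s).
  have finj : {in F &, injective f}.
    move=> u v uF vF /(congr1 val); rewrite /= !inordK; try exact: st.
    by have := smin _ uF; have := smin _ vF; move=> /= ? ? ?; apply/val_inj; rewrite /=; lia.
  by rewrite -(card_in_imset finj) max_card.
by rewrite card_ord; lia.
Qed.

(** In two columns of sizes [k] and [l], the spreads [max - min] are at
least [k - 1] and [l - 1], so that one of the two crossed differences of
extreme points dominates any difference between the centred columns. *)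
Lemma steiner_sqdist i A x y : x \in steiner i A -> y \in steiner i A ->
  exists x' y', [/\ x' \in A, y' \in A & sqdist x y <= sqdist x' y'].
Proof.
rewrite !inE => /card_spread[s [t [+ + st]]] /card_spread[u [v [+ + uv]]].
rewrite !inE => sA tA uA vA.
have key (a b : 'I_G) : (x i - y i) + (y i - x i) <= (a - b) + (b - a) ->
    sqdist x y <= sqdist (upd x i a) (upd y i b).
  move=> ab; apply: leq_sum => k _; rewrite !ffunE; case: eqP => // ->.
  by rewrite leq_exp2r.
have [H|H] : (x i - y i) + (y i - x i) <= (t - u) + (u - t) \/
    (x i - y i) + (y i - x i) <= (s - v) + (v - s).
  by move: st uv; rewrite /offset; lia.
- by exists (upd x i t), (upd y i u); split => //; exact: key.
- by exists (upd x i s), (upd y i v); split => //; exact: key.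
Qed.

(** Reflecting only the first [k] coordinates makes the symmetry grow by one
axis with each symmetrization. *)
Definition reflect k x : T := [ffun i : 'I_m => if i < k then rev_ord (x i) else x i].

Lemma reflect_upd (i : 'I_m) x t : reflect i (upd x i t) = upd (reflect i.+1 x) i t.
Proof.
apply/ffunP => j; rewrite !ffunE; have [->|ji] := eqVneq j i; first by rewrite ltnn.
by rewrite [in RHS]ltnS [in RHS]leq_eqVlt (negbTE (ji : (j != i :> nat))).
Qed.

Lemma steiner_reflect (i : 'I_m) A : (forall x, x \in A -> reflect i x \in A) ->
  forall x, x \in steiner i A -> reflect i.+1 x \in steiner i A.
Proof.
move=> sA x; rewrite !inE => xi.
have -> : offset (reflect i.+1 x i) = offset (x i).
  by rewrite ffunE ltnSn /offset/=; have := ltn_ord (x i); rewrite /G; lia.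
apply: leq_trans xi _; apply/subset_leq_card/fintype.subsetP => t.
by rewrite !inE -reflect_upd => /sA.
Qed.

(** Symmetrizing along all the axes gives a set that is symmetric about the
centre of the grid. *)
Lemma symmetrization A : exists B : {set T},
  [/\ #|A| <= #|B| + m * G ^ m',
      forall x y, x \in B -> y \in B ->
        exists x' y', [/\ x' \in A, y' \in A & sqdist x y <= sqdist x' y'] &
      forall x, x \in B -> [ffun i => rev_ord (x i)] \in B].
Proof.
suff H k : k <= m -> exists B : {set T},
  [/\ #|A| <= #|B| + k * G ^ m',
      forall x y, x \in B -> y \in B ->
        exists x' y', [/\ x' \in A, y' \in A & sqdist x y <= sqdist x' y'] &
      forall x, x \in B -> reflect k x \in B].
  have [B [B1 B2 B3]] := H m (leqnn _); exists B; split => // x /B3.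
  by congr (_ \in B); apply/ffunP => i; rewrite !ffunE ltn_ord.
elim: k => [_|k IH km].
  exists A; split => [|x y xA yA|x]; first by rewrite addn0.
    by exists x, y.
  by congr (_ \in A); apply/ffunP => i; rewrite !ffunE ltn0.
have [B [B1 B2 B3]] := IH (ltnW km); pose i := Ordinal km.
exists (steiner i B); split.
- by apply: leq_trans B1 _; have := card_steiner i B; rewrite mulSn; lia.
- move=> x y /steiner_sqdist/[apply] -[x1 [y1 [x1B y1B xy1]]].
  have [x2 [y2 [x2A y2A xy2]]] := B2 _ _ x1B y1B.
  by exists x2, y2; split => //; exact: leq_trans xy2.
- exact: (@steiner_reflect i).
Qed.

End steiner.
(** * The isodiametric inequality *)

(** Lets a small parameter tend to 0 in a family of bounds. *)
Lemma lee_cvg0 {R : realType} (X : \bar R) (f : R -> R) (D : R) : 0 < D ->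
  {for 0, continuous f} -> (forall N : nat, X <= (f (D / N.+1%:R))%:E)%E ->
  (X <= (f 0)%:E)%E.
Proof.
move=> D0 fc H; apply/lee_addgt0Pr => e e0.
move/cvgrPdist_le : fc => /(_ _ e0)/nbhs_normP[d /= d0 dP].
pose N := Num.trunc (D / d).
have Dd : D / N.+1%:R < d.
  by rewrite ltr_pdivrMr// mulrC -ltr_pdivrMr// truncnS_gt.
apply: le_trans (H N) _; rewrite -EFinD lee_fin.
have := dP (D / N.+1%:R); rewrite /ball_/= sub0r normrN gtr0_norm ?divr_gt0//.
by move=> /(_ Dd); rewrite ler_norml; lra.
Qed.

Lemma grid_index_range {R : realType} (n h d q : R) : 0 < h -> h * n = d + 1 ->
  - d <= (q - n) * h -> (q - n) * h <= d -> 0 < q /\ q < n + n.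
Proof.
by move=> h0 hn q1 q2; split; [rewrite -(pmulr_lgt0 _ h0)|rewrite -(ltr_pM2r h0)]; lra.
Qed.

Section isodiametric.
Context {R : realType} {m' : nat}.
Let m := m'.+1.
Variables (E : set 'rV[R]_m) (e0 : 'rV[R]_m) (delta : R).
Hypotheses (Ee0 : E e0)
  (Ediam : forall x y, E x -> E y -> enorm (x - y) <= delta).

Let delta_ge0 : 0 <= delta.
Proof. exact: le_trans (enorm_ge0 _) (Ediam Ee0 Ee0). Qed.

Section grid.
Variable N' : nat.
Let N := N'.+1.
Let h := (delta + 1) / N%:R.
Let G := {ffun 'I_m -> 'I_(N.*2.+1)}.

Let node (k : G) : 'rV[R]_m := \row_i (h * ((k i)%:R - N%:R)).

Let h_gt0 : 0 < h.
Proof. by rewrite divr_gt0// ltr_wpDl. Qed.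

Let hN : h * N%:R = delta + 1.
Proof. by rewrite /h divfK// pnatr_eq0. Qed.

Let enorm_node (k l : G) :
  enorm (node k - node l) = h * Num.sqrt (sqdist k l)%:R.
Proof.
rewrite -[h in RHS]gtr0_norm// -sqrtr_sqr -sqrtrM ?sqr_ge0//; congr Num.sqrt.
rewrite natr_sum mulr_sumr; apply: eq_bigr => i _; rewrite !mxE natrX.
case: (leqP (k i) (l i)) => [kl|/ltnW kl].
  by rewrite (eqP kl) add0n natrB//; ring.
by rewrite (eqP kl) addn0 natrB//; ring.
Qed.

Let le_enorm_box (v x : 'rV[R]_m) :
  box v (v + const_mx h) x -> enorm (x - v) <= m%:R * h.
Proof.
move=> Hx; apply: enorm_le_bound => i; have := Hx i; rewrite !mxE.
by rewrite ler_norml; have := h_gt0; lra.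
Qed.

Let box_volume_cube (v : 'rV[R]_m) : box_volume v (v + const_mx h) = h ^+ m.
Proof.
rewrite -[m in RHS]card_ord -prodr_const; apply: eq_bigr => i _.
by rewrite !mxE addrAC subrr add0r.
Qed.

Let le_cube (v : 'rV[R]_m) i : v 0 i <= (v + const_mx h) 0 i.
Proof. by rewrite !mxE lerDl ltW. Qed.

(** [A] collects the grid cubes that meet [E], and [B] is its symmetrization.
The points of [B] come with their opposites, so that their norms are at most
half the diameter of [A]; the cubes of [B] are then packed in a ball. The second
term accounts for the columns that lost a point. *)
Lemma isodiametric_grid : (lebesgue_outer E <=
  (unit_ball_volume R m * (delta / 2 + (2 * m%:R + 1) * h) ^+ m +
   m%:R * (3 * (delta + 1)) ^+ m' * h)%:E)%E.
Proof.
pose cube k := box (e0 + node k) (e0 + node k + const_mx h).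
pose A : {set G} := finset (fun k => `[< exists2 x, E x & cube k x >]).
have AE k : k \in A -> exists2 x, E x & cube k x by rewrite inE => /asboolP.
have covE x : E x -> exists2 k, k \in A & cube k x.
  move=> Ex.
  have H i : exists j : 'I_(N.*2.+1),
      e0 0 i + h * (j%:R - N%:R) < x 0 i <= e0 0 i + h * (j%:R - N%:R) + h.
    pose q := (x 0 i - e0 0 i) / h + N%:R.
    have xe : x 0 i - e0 0 i = (q - N%:R) * h by rewrite addrK divfK// gt_eqF.
    have xd : `|x 0 i - e0 0 i| <= delta.
      have := enorm_coord (x - e0) i; rewrite !mxE => H.
      exact: le_trans H (Ediam Ex Ee0).
    have := h_gt0 => h0; have := xd; rewrite xe ler_norml => /andP[q1 q2].
    have [q0 qNN] := grid_index_range h0 hN q1 q2.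
    have qM : q <= N.*2.+1%:R.
      move: qNN.
      by rewrite -natrD addnn => /ltW/le_trans; apply; rewrite ler_nat.
    have [j /andP[j1 j2]] := ceil_ord q0 qM; exists j.
    have -> : x 0 i = e0 0 i + (q - N%:R) * h by rewrite -xe addrC subrK.
    by apply/andP; split; nra.
  have [f Hf] := choice H; pose k : G := [ffun i => f i].
  have kx : cube k x by move=> i; rewrite !mxE ffunE.
  by exists k => //; rewrite inE; apply/asboolP; exists x.
have upper : (lebesgue_outer E <= (#|A|%:R * h ^+ m)%:E)%E.
  apply: le_trans (@lebesgue_outer_subadditive R m' G
    (fun k => if k \in A then cube k else set0) E _) _.
    by move=> x /covE[k kA kx]; exists k => //=; rewrite kA.
  apply: (@le_trans _ _ (\sum_(k : G) (if k \in A then h ^+ m else 0)%:E)%E).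
    apply: lee_sum => k _; case: ifP => _; last by rewrite lebesgue_outer0.
    rewrite -(box_volume_cube (e0 + node k)); apply: lebesgue_outer_box_le => i.
    exact: le_cube.
  by rewrite sumEFin lee_fin -big_mkcond/= sumr_const mulr_natl.
have [B [cardB distB symB]] := symmetrization A.
(* [m%:R * h] bounds the diagonal of a cube *)
have diamA k l : k \in A -> l \in A ->
    enorm (node k - node l) <= delta + 2 * m%:R * h.
  move=> /AE[x Ex kx] /AE[y Ey ly].
  have := le_enorm_box kx; have := le_enorm_box ly; have := Ediam Ex Ey.
  set u := e0 + node k; set v := e0 + node l => xy yv xu.
  have -> : node k - node l = (u - x) + (x - y) + (y - v).
    by rewrite !addrA !subrK /u /v opprD addrACA subrr add0r.
  have := ler_enormD ((u - x) + (x - y)) (y - v).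
  have := ler_enormD (u - x) (x - y).
  by rewrite (enormB u); lra.
have ballB k : k \in B -> enorm (node k) <= delta / 2 + m%:R * h.
  move=> kB; have kB' := symB _ kB; set k' := finfun _ in kB'.
  have [x [y [xA yA xy]]] := distB _ _ kB kB'.
  have : enorm (node k - node k') <= delta + 2 * m%:R * h.
    apply: le_trans (diamA _ _ xA yA); rewrite !enorm_node.
    by rewrite ler_pM2l// ler_wsqrtr// ler_nat.
  have -> : node k' = - node k.
    apply/rowP => i; rewrite !mxE ffunE /=.
    have kN : (k i <= N.*2)%N by rewrite -ltnS.
    have NN : N.*2%:R = N%:R + N%:R :> R by rewrite -natrD addnn.
    by rewrite subSS natrB// NN; ring.
  by rewrite opprK -mulr2n -scaler_nat enormZ ger0_norm//; lra.
have lower : ((#|B|%:R * h ^+ m)%:E <=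
    (unit_ball_volume R m * (delta / 2 + (2 * m%:R + 1) * h) ^+ m)%:E)%E.
  have rho0 : 0 < delta / 2 + (2 * m%:R + 1) * h.
    by rewrite ltr_wpDl ?divr_ge0// mulr_gt0// ltr_wpDl// mulr_ge0.
  rewrite -(lebesgue_outer_eball 0 rho0).
  (* boxes outside [B] are degenerate, hence empty *)
  have := @lebesgue_outer_lower R m' G node
    (fun k => if k \in B then node k + const_mx h else node k) (eball 0 (delta / 2 + (2 * m%:R + 1) * h)).
  have -> : \sum_k box_volume (node k)
      (if k \in B then node k + const_mx h else node k) = #|B|%:R * h ^+ m.
    rewrite mulr_natl -sumr_const [RHS]big_mkcond/=; apply: eq_bigr => k _.
    case: ifP => _; first exact: box_volume_cube.
    by rewrite /box_volume big_ord_recl subrr mul0r.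
  have boxB k x : box (node k) (if k \in B then node k + const_mx h else node k) x ->
      k \in B /\ box (node k) (node k + const_mx h) x.
    by case: ifP => // _ /(_ ord0)/andP[a /(lt_le_trans a)]; rewrite ltxx.
  apply.
  - by move=> k i; case: ifP.
  - move=> k x /boxB[kB /le_enorm_box kx].
    rewrite /eball/= subr0; have := ballB _ kB.
    have := ler_enormD (x - node k) (node k); rewrite subrK.
    by have := h_gt0; lra.
  - move=> k l x /boxB[_ kx] /boxB[_ lx]; apply/ffunP => i; apply/val_inj => /=.
    have := kx i; have := lx i; rewrite !mxE => /andP[l1 l2] /andP[k1 k2].
    have h0 := h_gt0.
    have lk : ((l i)%:R < (k i)%:R + 1 :> R) by rewrite -(ltr_pM2l h0); lra.
    have kl : ((k i)%:R < (l i)%:R + 1 :> R) by rewrite -(ltr_pM2l h0); lra.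
    move: lk kl; rewrite !natr1 !ltr_nat !ltnS => lk kl.
    by apply/eqP; rewrite eqn_leq lk kl.
apply: (le_trans upper); rewrite lee_fin in lower *.
have h0 := h_gt0.
have cardA : (#|A|%:R <= #|B|%:R + m%:R * N.*2.+1%:R ^+ m' :> R).
  by rewrite -natrX -natrM -natrD ler_nat.
have Gh : N.*2.+1%:R ^+ m' * h ^+ m <= (3 * (delta + 1)) ^+ m' * h.
  have a0 : 0 <= N.*2.+1%:R * h by apply: mulr_ge0; [exact: ler0n|exact: ltW].
  have ab : N.*2.+1%:R * h <= 3 * (delta + 1).
    rewrite -hN [h * _]mulrC [leRHS]mulrA; apply: ler_wpM2r; first exact: ltW.
    by rewrite -natrM ler_nat /N; lia.
  have -> : h ^+ m = h ^+ m' * h by exact: exprSr.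
  rewrite [leLHS]mulrA; apply: ler_wpM2r; first exact: ltW.
  rewrite -exprMn; apply: lerXn2r => //; rewrite nnegrE; exact: le_trans a0 ab.
apply: (@le_trans _ _ ((#|B|%:R + m%:R * N.*2.+1%:R ^+ m') * h ^+ m)).
  by rewrite ler_wpM2r// exprn_ge0// ltW.
rewrite mulrDl lerD// -[leLHS]mulrA -[leRHS]mulrA ler_wpM2l//.
Qed.

End grid.

Lemma isodiametric_nonempty :
  (lebesgue_outer E <= (unit_ball_volume R m * (delta / 2) ^+ m)%:E)%E.
Proof.
pose f (h : R) := unit_ball_volume R m * (delta / 2 + (2 * m%:R + 1) * h) ^+ m +
   m%:R * (3 * (delta + 1)) ^+ m' * h.
have -> : unit_ball_volume R m * (delta / 2) ^+ m = f 0.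
  by rewrite /f !mulr0 !addr0.
apply: (@lee_cvg0 _ _ f (delta + 1)); first by rewrite ltr_wpDl.
  have : continuous (fun h : R => f h).
    move=> h; apply: cvgD; last by apply: cvgM; [exact: cvg_cst|exact: cvg_id].
    apply: cvgM; first exact: cvg_cst.
    apply: (@cvg_comp _ _ _ (fun h : R => delta / 2 + (2 * m%:R + 1) * h)
      (fun x => x ^+ m)); last exact: exprn_continuous.
    apply: cvgD; first exact: cvg_cst.
    by apply: cvgM; [exact: cvg_cst|exact: cvg_id].
  exact.
exact: isodiametric_grid.
Qed.

End isodiametric.

Lemma isodiametric {R : realType} {m' : nat} (E : set 'rV[R]_m'.+1) (delta : R) :
  0 <= delta -> (forall x y, E x -> E y -> enorm (x - y) <= delta) ->
  (lebesgue_outer E <= (unit_ball_volume R m'.+1 * (delta / 2) ^+ m'.+1)%:E)%E.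
Proof.
move=> d0 Ed; have [->|/set0P[e0 Ee0]] := eqVneq E set0; last first.
  exact: isodiametric_nonempty Ee0 Ed.
rewrite lebesgue_outer0 lee_fin mulr_ge0 ?exprn_ge0 ?divr_ge0//.
by rewrite ltW// unit_ball_volume_gt0.
Qed.

(** * Area of a set that surrounds a ball *)

Section slab.
Context {R : realType} {m' : nat}.
Let m := m'.+1.
Let n := m.+1.
Implicit Types (u v w y p : 'rV[R]_n).

Definition orthopart p w : 'rV[R]_n := w - dotmul w p *: p.

Lemma orthopartD p u v : orthopart p (u + v) = orthopart p u + orthopart p v.
Proof. by apply/rowP => i; rewrite /orthopart dotmulDl !mxE; ring. Qed.

Lemma orthopartB p u v : orthopart p (u - v) = orthopart p u - orthopart p v.
Proof. by apply/rowP => i; rewrite /orthopart dotmulDl dotmulNl !mxE; ring. Qed.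

Lemma orthopartZ p c u : orthopart p (c *: u) = c *: orthopart p u.
Proof. by rewrite /orthopart dotmulZl scalerBr scalerA. Qed.

Lemma sqr_orthopart p w : enorm p = 1 ->
  enorm (orthopart p w) ^+ 2 = enorm w ^+ 2 - dotmul w p ^+ 2.
Proof.
move=> p1; have pp : dotmul p p = 1 by rewrite -sqr_enorm p1 expr1n.
by rewrite !sqr_enorm !dotmulE pp (dotmulC p w); ring.
Qed.

Lemma le_enorm_orthopart p w : enorm p = 1 -> enorm (orthopart p w) <= enorm w.
Proof.
move=> p1; rewrite ler_enormP// -sqr_enorm sqr_orthopart//.
by rewrite gerBl sqr_ge0.
Qed.

(** After a rotation that sends [p] to the first axis up to sign, [S] lies in a
cylinder over its projection, to which the isodiametric inequality applies. *)
Lemma lebesgue_outer_slab (S : set 'rV[R]_n) p (lo h delta : R) :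
  enorm p = 1 -> 0 < h -> 0 <= delta ->
  (forall y, S y -> lo < dotmul y p < lo + h) ->
  (forall y y', S y -> S y' -> enorm (orthopart p (y - y')) <= delta) ->
  (lebesgue_outer S <= (h * (unit_ball_volume R m * (delta / 2) ^+ m))%:E)%E.
Proof.
move=> p1 h0 d0 Sp Sd; have [Q [vQ Qp]] := rotate_to_axis p.
have [QB Qn QA] := vQ.
pose k := Q p 0 ord0.
have Qdot y : dotmul y p = Q y 0 ord0 * k.
  rewrite -(volume_isometry_dotmul y p vQ) /dotmul big_ord_recl big1 ?addr0// => i _.
  by rewrite (Qp (lift ord0 i))// mulr0.
have k2 : k ^+ 2 = 1.
  by rewrite expr2 -Qdot -sqr_enorm p1 expr1n.
have Qy0 y : Q y 0 ord0 = dotmul y p * k by rewrite Qdot -mulrA -expr2 k2 mulr1.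
(* [k = -1] when the rotation reverses [p], and the slab is reversed with it *)
pose c := if k == 1 then lo else - lo - h.
pose drop (y : 'rV[R]_n) : 'rV[R]_m := \row_i y 0 (lift ord0 i).
pose A : set 'rV[R]_m := [set drop (Q y) | y in S].
apply: (@le_trans _ _ (lebesgue_outer (Q @^-1` [set y | A (drop y) /\ (c < y 0%R ord0 <= c + h)%R]))).
  apply: le_lebesgue_outer => y Sy; split; first by exists y.
  have [y1 y2] := andP (Sp _ Sy); rewrite Qy0 /c.
  have : (k - 1) * (k + 1) = 0 by rewrite -subr_sqr_1 k2 subrr.
  move/eqP; rewrite mulf_eq0 subr_eq0 addr_eq0 => /orP[/eqP->|/eqP->].
    by rewrite eqxx; lra.
  by rewrite ifN; [lra|rewrite lt_eqF//; lra].
apply: le_trans (QA _) _.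
apply: le_trans (lebesgue_outer_cylinder _ _ h0) _.
rewrite EFinM lee_pmul2l//.
apply: isodiametric => // _ _ [y Sy <-] [y' Sy' <-].
apply: le_trans (Sd _ _ Sy Sy').
rewrite ler_enormP// sqr_orthopart// -[enorm (y - y')]Qn QB.
have -> : dotmul (y - y') p ^+ 2 = (Q y - Q y') 0 ord0 ^+ 2.
  by rewrite -QB Qdot exprMn k2 mulr1.
rewrite !sqr_enorm [X in _ <= X - _]/dotmul big_ord_recl -expr2 addrAC subrr add0r.
by rewrite le_eqVlt; apply/orP; left; apply/eqP/eq_bigr => i _; rewrite !mxE.
Qed.

(** The directions of a small set form an almost flat patch of the sphere, so
that the piece of shell over them lies in a slab orthogonal to one of these
directions: curvature adds at most [e ^+ 2 * r] to the height of the slab, and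
the thickness of the shell a factor [1 + e] to its width. *)
Lemma lebesgue_outer_shell (V : set 'rV[R]_n) (r e D : R) :
  0 < r -> 0 < e < 1 -> 0 <= D <= e * r ->
  (forall v, V v -> r <= enorm v) ->
  (forall v w, V v -> V w -> enorm (v - w) <= D) ->
  (lebesgue_outer [set y | exists s v,
      [/\ V v, (1 - e <= s)%R, (s < 1)%R & y = (s *: ((r / enorm v) *: v))%R]] <=
   ((1 + e) ^+ m.+1 * (e * r) * (unit_ball_volume R m * (D / 2) ^+ m))%:E)%E.
Proof.
move=> r0 /andP[e0 e1] /andP[D0 De] Vr VD.
set S := (X in lebesgue_outer X).
have [->|/set0P[_ [_ [v0 [Vv0 _ _ _]]]]] := eqVneq S set0.
  rewrite lebesgue_outer0 lee_fin; apply: mulr_ge0.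
    by apply: mulr_ge0; [apply: exprn_ge0; lra|exact: le_trans De].
  by rewrite mulr_ge0 ?exprn_ge0 ?divr_ge0// ltW// unit_ball_volume_gt0.
have V0 v : V v -> 0 < enorm v by move=> /Vr; exact: lt_le_trans.
pose theta v : 'rV[R]_n := (r / enorm v) *: v; pose p : 'rV[R]_n := (enorm v0)^-1 *: v0.
have p1 : enorm p = 1.
  by rewrite enormZ gtr0_norm ?invr_gt0 ?V0// mulVf// gt_eqF// V0.
have thetap : theta v0 = r *: p by rewrite /theta /p scalerA.
have ntheta v : V v -> enorm (theta v) = r.
  move=> Vv; rewrite enormZ gtr0_norm ?divr_gt0 ?V0// divfK// gt_eqF// V0//.
have dtheta v w : V v -> V w -> enorm (theta v - theta w) <= D.
  by move=> Vv Vw; apply: le_trans (VD _ _ Vv Vw); apply: radial_contraction => //; exact: Vr.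
have ptheta v : V v -> (1 - e ^+ 2 / 2) * r <= dotmul (theta v) p <= r.
  move=> Vv; apply/andP; split.
    have : enorm (theta v - theta v0) ^+ 2 <= (e * r) ^+ 2.
      have H := le_trans (dtheta _ _ Vv Vv0) De.
      have er := le_trans D0 De.
      by apply: lerXn2r => //; rewrite nnegrE ?enorm_ge0.
    rewrite sqr_enormB !ntheta// thetap dotmulZr => H.
    rewrite -(ler_pM2l r0); lra.
  by apply: le_trans (dotmul_le _ _) _; rewrite ntheta// p1 mulr1.
have otheta v : V v -> enorm (orthopart p (theta v)) <= D.
  move=> Vv; apply: le_trans (dtheta _ _ Vv Vv0).
  apply: le_trans (le_enorm_orthopart _ p1).
  rewrite orthopartB thetap [X in _ - X](_ : _ = 0) ?subr0//.
  by rewrite orthopartZ /orthopart -sqr_enorm p1 expr1n scale1r subrr scaler0.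
pose h := e * r * (1 + e); pose delta := (1 + e) * D.
have h0 : 0 < h by rewrite !mulr_gt0// addr_gt0.
have d0 : 0 <= delta by rewrite mulr_ge0// addr_ge0// ltW.
have := @lebesgue_outer_slab S p (r - h) h delta p1 h0 d0.
have -> : h * (unit_ball_volume R m * (delta / 2) ^+ m) =
  (1 + e) ^+ m.+1 * (e * r) * (unit_ball_volume R m * (D / 2) ^+ m).
  by rewrite /delta -mulrA exprMn exprS /h; ring.
apply.
- move=> _ [s [v [Vv s1 s2 ->]]]; rewrite subrK dotmulZl.
  have /andP[] := ptheta _ Vv; set X := dotmul _ p => X1 X2.
  have X0 : 0 < X.
    apply: lt_le_trans X1; rewrite mulr_gt0// subr_gt0 ltr_pdivrMr//.
    by rewrite mul1r; nra.
  have ee : 0 < e * e by rewrite mulr_gt0.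
  have sX : (1 - e) * ((1 - e ^+ 2 / 2) * r) <= s * X.
    apply: ler_pM => //; first by rewrite subr_ge0 ltW.
    by rewrite mulr_ge0 ?(ltW r0)// subr_ge0 ler_pdivrMr// mul1r; nra.
  apply/andP; split.
    apply: lt_le_trans sX; rewrite /h -subr_gt0.
    have -> : (1 - e) * ((1 - e ^+ 2 / 2) * r) - (r - e * r * (1 + e)) =
      r * (e * e) * ((1 + e) / 2) by field.
    by rewrite !mulr_gt0 ?invr_gt0 ?addr_gt0.
  by apply: lt_le_trans X2; rewrite gtr_pMl.
- move=> _ _ [s [v [Vv s1 s2 ->]]] [t [w [Vw t1 t2 ->]]].
  rewrite -/(theta v) -/(theta w).
  have -> : s *: theta v - t *: theta w =
      s *: (theta v - theta w) + (s - t) *: theta w.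
    by rewrite scalerBr scalerBl addrA subrK.
  rewrite orthopartD (orthopartZ p s) (orthopartZ p (s - t)).
  apply: le_trans (ler_enormD _ _) _.
  rewrite (enormZ s) (enormZ (s - t)) /delta mulrDl mul1r.
  have s_le : `|s| <= 1 by rewrite ler_norml; lra.
  have st_le : `|s - t| <= e by rewrite ler_norml; lra.
  apply: lerD; last by apply: ler_pM; rewrite ?enorm_ge0//; exact: otheta.
  rewrite -[leRHS]mul1r; apply: ler_pM; rewrite ?enorm_ge0//.
  exact: le_trans (le_enorm_orthopart _ p1) (dtheta _ _ Vv Vw).
Qed.

End slab.
Section surrounding.
Context {R : realType} {m' : nat}.
Let m := m'.+1.
Let n := m.+1.
Variables (K : set 'rV[R]_n) (x0 : 'rV[R]_n) (r : R).
Hypotheses (r_gt0 : 0 < r)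
  (K_rays : forall v, enorm v = r -> exists x,
    [/\ K x, r <= enorm (x - x0) & v = (r / enorm (x - x0)) *: (x - x0)]).

(** Covering sets of diameter at most [e * r] are flat at the scale of the height
of the shell. *)
Lemma shell_le_hausdorff_pre (e : R) : 0 < e < 1 ->
  (lebesgue_outer (eball (0 : 'rV[R]_n) r `\` eball 0 ((1 - e) * r)) <=
   ((1 + e) ^+ n * (e * r))%:E * @hausdorff_pre R n m (e * r) K)%E.
Proof.
move=> /andP[e0 e1].
set C := (1 + e) ^+ n * (e * r).
have C0 : 0 < C by rewrite mulr_gt0 ?exprn_gt0 ?mulr_gt0 ?addr_gt0.
rewrite -lee_pdivrMl//; apply: le_ereal_inf_tmp => _ [A [Ad KA] <-].
rewrite lee_pdivrMl//.
pose V k : set 'rV[R]_n := [set v | A k (v + x0) /\ r <= enorm v].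
pose S k : set 'rV[R]_n := [set y | exists s v,
  [/\ V k v, (1 - e <= s)%R, (s < 1)%R & y = (s *: ((r / enorm v) *: v))%R]].
apply: (@le_trans _ _ (\sum_(k <oo) lebesgue_outer (S k))%E).
  apply: le_trans (lebesgue_outer_sigma_subadditive _).
  apply: le_lebesgue_outer => y [/=]; rewrite /eball/= !subr0 => yr /negP.
  rewrite -leNgt => yer.
  have y0 : 0 < enorm y by apply: lt_le_trans yer; rewrite mulr_gt0// subr_gt0.
  have [|x [Kx rx vx]] := K_rays (v := (r / enorm y) *: y).
    by rewrite enormZ gtr0_norm ?divr_gt0// divfK// gt_eqF.
  have [k _ Akx] := KA _ Kx; exists k => //.
  exists (enorm y / r), (x - x0); split.
  - by split => //=; rewrite subrK.
  - by rewrite ler_pdivlMr.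
  - by rewrite ltr_pdivrMr// mul1r.
  - rewrite -vx scalerA mulrA divfK ?gt_eqF// divff ?gt_eqF// scale1r//.
rewrite -nneseriesZl; last by move=> k _; exact: hausdorff_gauge_ge0.
apply: lee_nneseries => [k _ _|k _]; first exact: lebesgue_outer_ge0.
have [A0|A0] := eqVneq (A k) set0.
  rewrite [X in lebesgue_outer X](_ : _ = set0).
    by rewrite lebesgue_outer0 mule_ge0 ?hausdorff_gauge_ge0// lee_fin ltW.
  by rewrite -subset0 => y [s [v [[]]]]; rewrite A0.
have /= Akd := Ad k.
have d_ge x y : A k x -> A k y -> ((enorm (x - y))%:E <= ediam (A k))%E.
  by move=> Ax Ay; apply: ereal_sup_ubound; exists x => //; exists y.
have d0 : (0 <= ediam (A k))%E.
  have /set0P[x Ax] := A0; apply: le_trans (d_ge _ _ Ax Ax).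
  by rewrite lee_fin enorm_ge0.
have dfin : ediam (A k) \is a fin_num by rewrite ge0_fin_numE// (le_lt_trans Akd)// ltey.
rewrite /hausdorff_gauge (negbTE A0).
pose D := fine (ediam (A k)); have DE : ediam (A k) = D%:E by rewrite fineK.
rewrite DE in Akd d0 d_ge *.
have := @lebesgue_outer_shell R m' (V k) r e D r_gt0.
rewrite e0 e1 -lee_fin d0 -lee_fin Akd => /(_ isT isT) H.
apply: (le_trans (H _ _)) => [v []//|v w [Av _] [Aw _]|].
  by rewrite -lee_fin; have := d_ge _ _ Av Aw; rewrite opprD addrACA subrr addr0.
rewrite -EFin_expe -EFinM lee_fin le_eqVlt; apply/orP; left; apply/eqP.
by rewrite /C /n expr_div_n; ring.
Qed.

Lemma area_surrounding : (@hausdorff R n m K < +oo)%E ->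
  ((n%:R * unit_ball_volume R n * r ^+ m)%:E <= @hausdorff R n m K)%E.
Proof.
move=> Kfin; set w := unit_ball_volume R n.
have Kfn : @hausdorff R n m K \is a fin_num.
  by rewrite ge0_fin_numE// hausdorff_ge0.
pose H := fine (@hausdorff R n m K); have HE : @hausdorff R n m K = H%:E by rewrite fineK.
have w0 : 0 < w by exact: unit_ball_volume_gt0.
pose c := n%:R * w * r ^+ m.
pose f (e : R) := (1 + e) ^+ n * H + c * (1 - (1 - e) ^+ n).
have -> : @hausdorff R n m K = (f 0)%:E.
  by rewrite /f !(addr0, subr0) !expr1n subrr mulr0 mul1r addr0.
(* [f e] is what comes out of comparing volumes for the shell of thickness
   [e * r] *)
apply: (@lee_cvg0 _ _ f 2^-1) => //.
  have cp : continuous (fun x : R => x ^+ n) by exact: exprn_continuous.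
  have : continuous (fun e : R => f e).
    move=> e; apply: cvgD.
      apply: cvgM; last exact: cvg_cst.
      apply: (@cvg_comp _ _ _ (fun e : R => 1 + e) (fun x => x ^+ n)); last exact: cp.
      by apply: cvgD; [exact: cvg_cst|exact: cvg_id].
    apply: cvgM; first exact: cvg_cst.
    apply: cvgB; first exact: cvg_cst.
    apply: (@cvg_comp _ _ _ (fun e : R => 1 - e) (fun x => x ^+ n)); last exact: cp.
    by apply: cvgB; [exact: cvg_cst|exact: cvg_id].
  exact.
move=> N; set e := _ / _.
have e0 : 0 < e by rewrite divr_gt0// invr_gt0.
have e1 : e < 1.
  rewrite ltr_pdivrMr// mul1r; apply: (@lt_le_trans _ _ 1); last by rewrite ler1n.
  by rewrite invf_lt1// ltr1n.
have e01 : 0 < e < 1 by rewrite e0.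
have er0 : 0 < (1 - e) * r by rewrite mulr_gt0// subr_gt0.
have : (lebesgue_outer (eball (0 : 'rV[R]_n) r) <=
    lebesgue_outer (eball (0 : 'rV[R]_n) r `\` eball 0 ((1 - e) * r)) +
    lebesgue_outer (eball (0 : 'rV[R]_n) ((1 - e) * r)))%E.
  apply: le_trans (lebesgue_outerU _ _); apply: le_lebesgue_outer => y yr.
  have [yb|yb] := pselect (eball 0 ((1 - e) * r) y); [by right|by left].
rewrite !lebesgue_outer_eball// => H1.
have H2 : (lebesgue_outer (eball (0 : 'rV[R]_n) r `\` eball 0 ((1 - e) * r)) <=
    ((1 + e) ^+ n * (e * r) * H)%:E)%E.
  apply: le_trans (shell_le_hausdorff_pre e01) _.
  have C0 : 0 < (1 + e) ^+ n * (e * r).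
    by apply: mulr_gt0; [apply: exprn_gt0; lra|exact: mulr_gt0].
  rewrite [leRHS]EFinM lee_pmul2l//.
  by rewrite -HE hausdorff_pre_le// mulr_gt0.
have {H1 H2} := le_trans H1 (leeD2r _ H2).
rewrite -/w -EFinD lee_fin exprMn => H3.
have {}H3 : w * r ^+ n * (1 - (1 - e) ^+ n) <= (1 + e) ^+ n * (e * r) * H.
  set q := (1 - e) ^+ n in H3 *; set P := (1 + e) ^+ n in H3 *.
  by set rn := r ^+ n in H3 *; lra.
have H4 : n%:R * e * (1 - e) ^+ n <= 1 - (1 - e) ^+ n.
  have -> : 1 - (1 - e) ^+ n = e * \sum_(i < n) (1 - e) ^+ i.
    by rewrite -[LHS]opprB subrX1 -mulNr; congr (_ * _); ring.
  rewrite [_ * e]mulrC -mulrA ler_pM2l// -[n in n%:R]card_ord -sumr_const mulr_suml.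
  apply: ler_sum => i _; rewrite mul1r; apply: ler_wiXn2l; last exact: ltnW.
    by rewrite subr_ge0 ltW.
  by rewrite gerBl ltW.
rewrite lee_fin /f -/c.
have er : 0 < e * r by rewrite mulr_gt0.
suff : c * (1 - e) ^+ n <= (1 + e) ^+ n * H by lra.
rewrite -(ler_pM2l er).
apply: le_trans (_ : (1 + e) ^+ n * (e * r) * H <= _); last first.
  by rewrite le_eqVlt; apply/orP; left; apply/eqP; ring.
apply: le_trans H3.
have -> : e * r * (c * (1 - e) ^+ n) = w * r ^+ n * (n%:R * e * (1 - e) ^+ n).
  have -> : r ^+ n = r ^+ m * r by exact: exprSr.
  rewrite /c; move: ((1 - e) ^+ n) (r ^+ m) (n%:R) => q rm k; clearbody e w; ring.
by rewrite ler_pM2l// mulr_gt0// exprn_gt0.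
Qed.

End surrounding.

(** * Closed sets are Caratheodory measurable for Hausdorff measure *)

Lemma sum_even_odd {R : realType} (f : nat -> \bar R) N :
  (\sum_(i < N.*2) f i = \sum_(i < N) f (i.*2 + 0)%N + \sum_(i < N) f (i.*2 + 1)%N)%E.
Proof.
elim: N => [|N IH]; first by rewrite !big_ord0 adde0.
rewrite doubleS !big_ord_recr/= IH addn0 addn1.
by rewrite -!addeA; congr (_ + _)%E; rewrite addeCA.
Qed.

Section hausdorff_closed.
Local Open Scope ereal_scope.
Context {R : realType} {n : nat} (k : nat).
Implicit Types (A B F X : set 'rV[R]_n) (x y : 'rV[R]_n).
Local Notation H := (@hausdorff R n k).

Lemma le_hausdorff_pre (d d' : R) A : (d <= d')%R ->
  hausdorff_pre k d' A <= hausdorff_pre k d A.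
Proof.
move=> dd'; apply: le_ereal_inf_tmp => _ [F [Fd AF] <-].
apply: ereal_inf_lbound; exists F => //; split => // i.
by apply: le_trans (Fd i) _; rewrite lee_fin.
Qed.

(** No set of a fine enough covering meets both of two separated sets. *)
Lemma hausdorff_pre_separated (d d0 : R) A B : (d < d0)%R ->
  (forall x y, A x -> B y -> (d0 <= enorm (x - y))%R) ->
  hausdorff_pre k d A + hausdorff_pre k d B <= hausdorff_pre k d (A `|` B).
Proof.
move=> dd0 AB; apply: le_ereal_inf_tmp => _ [F [Fd ABF] <-].
pose G C i := if F i `&` C == set0 then set0 else F i.
have GF C i : ediam (G C i) <= d%:E.
  by rewrite /G; case: ifP => _; [rewrite ediam0 leNye|exact: Fd].
have GC C : C `<=` A `|` B -> C `<=` \bigcup_i G C i.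
  move=> CAB x Cx; have [i _ Fx] := ABF _ (CAB _ Cx); exists i => //.
  by rewrite /G ifN//; apply/set0P; exists x.
have pre C : C `<=` A `|` B ->
    hausdorff_pre k d C <= \sum_(i <oo) hausdorff_gauge k (G C i).
  by move=> CAB; apply: ereal_inf_lbound; exists (G C) => //; split; [exact: GF|exact: GC].
apply: le_trans (leeD (pre A _) (pre B _)) _; [exact: subsetUl|exact: subsetUr|].
rewrite -nneseriesD; [|by move=> i _ _; exact: hausdorff_gauge_ge0..].
apply: lee_nneseries => i _; first by rewrite adde_ge0 ?hausdorff_gauge_ge0.
rewrite /G; case: ifPn => [_|/set0P[x [Fx Ax]]].
  by rewrite hausdorff_gauge0 add0e; case: ifP => _ //; rewrite hausdorff_gauge0 hausdorff_gauge_ge0.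
case: ifPn => [_|/set0P[y [Fy By]]]; first by rewrite hausdorff_gauge0 adde0.
have : (enorm (x - y))%:E <= d%:E.
  by apply: le_trans (Fd i); apply: ereal_sup_ubound; exists x => //; exists y.
by rewrite lee_fin leNgt (lt_le_trans dd0 (AB _ _ Ax By)).
Qed.

Lemma hausdorff_separated (d0 : R) A B : (0 < d0)%R ->
  (forall x y, A x -> B y -> (d0 <= enorm (x - y))%R) ->
  H A + H B <= H (A `|` B).
Proof.
move=> d00 AB.
have key (d d' : R) : (0 < d)%R -> (0 < d')%R ->
    hausdorff_pre k d A + hausdorff_pre k d' B <= H (A `|` B).
  move=> dp dp'; pose e : R := Num.min (d0 / 2)%R (Num.min d d').
  have e0 : (0 < e)%R by rewrite !lt_min dp dp' divr_gt0.
  have ed0 : (e < d0)%R.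
    by rewrite gt_min; apply/orP; left; rewrite ltr_pdivrMr// ltr_pMr// ltr1n.
  apply: le_trans (hausdorff_pre_le k (A `|` B) e0).
  apply: le_trans (hausdorff_pre_separated ed0 AB).
  by apply: leeD; apply: le_hausdorff_pre; rewrite !ge_min lexx ?orbT.
have [->|fin] := eqVneq (H (A `|` B)) +oo; first by rewrite leey.
have preB d : (0 < d)%R -> hausdorff_pre k d B \is a fin_num.
  move=> dp; rewrite ge0_fin_numE; last by apply: cover_outer_ge0; exact: hausdorff_gauge_ge0.
  apply: le_lt_trans (hausdorff_pre_le k B dp) _.
  by apply: le_lt_trans (le_hausdorff k (@subsetUr _ A B)) _; rewrite ltey.
have HA d' : (0 < d')%R -> H A <= H (A `|` B) - hausdorff_pre k d' B.
  move=> dp'; apply: ge_ereal_sup => _ [d dp <-].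
  by rewrite leeBrDr ?preB//; exact: key.
have HAfin : H A \is a fin_num.
  rewrite ge0_fin_numE ?hausdorff_ge0//.
  by apply: le_lt_trans (le_hausdorff k (@subsetUl _ A B)) _; rewrite ltey.
rewrite addeC -leeBrDr//; apply: ge_ereal_sup => _ [d dp <-].
by rewrite leeBrDr// addeC -leeBrDr ?preB//; exact: HA.
Qed.

(** The argument of Caratheodory for metric outer measures. The part of [X]
outside [F] is cut into layers according to the distance to [F]. Layers whose
indices differ by two are separated, so that the even layers and the odd layers
each have total measure at most [H X]; the layers near [F] therefore have small
total measure, and what is left is separated from [F]. *)
Lemma caratheodory_closed F : closed F -> caratheodory_measurable H F.
Proof.
move=> cF; apply: le_caratheodory_measurable => X.
rewrite -[leLHS]/(H (X `&` F) + H (X `&` ~` F)) -[leRHS]/(H X).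
have [->|Xoo] := eqVneq (H X) +oo; first by rewrite leey.
have Xfin : H X \is a fin_num by rewrite ge0_fin_numE ?hausdorff_ge0// ltey.
pose U j : set 'rV[R]_n := [set x | forall y, F y -> (j.+1%:R^-1 <= enorm (x - y))%R].
have subU i j : (i <= j)%N -> U i `<=` U j.
  move=> ij x Ux y Fy; apply: le_trans (Ux _ Fy).
  by rewrite lef_pV2 ?posrE// ler_nat.
have bigU : ~` F `<=` \bigcup_j U j.
  move=> x nFx; have : nbhs x (~` F) by apply: open_nbhs_nbhs; split => //; exact: closed_openC.
  move=> /nbhs_eballP[e e0 eF]; exists (Num.trunc e^-1) => // y Fy.
  rewrite leNgt; apply/negP => xy; apply: (eF y _ Fy).
  rewrite /eball/= enormB; apply: lt_le_trans xy _.
  by rewrite -[leRHS]invrK lef_pV2 ?posrE ?invr_gt0// ltW// truncnS_gt.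
pose L j := X `&` (U j.+2 `\` U j.+1).
have sepU i j x z : (i < j)%N -> U i x -> ~ U j z ->
    (i.+1%:R^-1 - j.+1%:R^-1 <= enorm (x - z))%R.
  move=> ij Ux /existsNP[y /not_implyP[Fy /negP]]; rewrite -ltNge => zy.
  rewrite lerBlDr; apply: le_trans (Ux _ Fy) _.
  by apply: le_trans (ler_enorm_dist _ z _) _; rewrite lerD2l ltW.
have gap i j : (i < j)%N -> (0 < i.+1%:R^-1 - j.+1%:R^-1 :> R)%R.
  by move=> ij; rewrite subr_gt0 ltf_pV2 ?posrE// ltr_nat ltnS.
have sumL o N : \sum_(i < N) H (L (i.*2 + o)%N) <= H (X `&` U (N.*2 + o)%N).
  elim: N => [|N IH]; first by rewrite big_ord0 hausdorff_ge0.
  rewrite big_ord_recr/=; apply: le_trans (leeD2r _ IH) _.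
  apply: le_trans (hausdorff_separated (gap _ _ (ltnSn (N.*2 + o))) _) _.
    by move=> x z [_ Ux] [_ [_ Uz]]; exact: sepU.
  apply: le_hausdorff => x [[Xx Ux]|[Xx [Ux _]]]; split => //.
  by apply: subU Ux; rewrite doubleS !addSn -addn2 leq_addr.
have sumLX N : \sum_(i < N.*2) H (L i) <= H X + H X.
  rewrite (sum_even_odd (fun i => H (L i))).
  by apply: leeD; apply: le_trans (sumL _ N) _; apply: le_hausdorff; exact: subIsetl.
have L0 j : 0 <= H (L j) by exact: hausdorff_ge0.
have serL : \sum_(j <oo) H (L j) < +oo.
  apply: (@le_lt_trans _ _ (H X + H X)); last by rewrite lte_add_pinfty// ltey.
  apply: lime_le; first exact: is_cvg_nneseries.
  apply: nearW => N; rewrite big_mkord; apply: le_trans (sumLX N).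
  rewrite -addnn big_split_ord/= leeDl//; exact: sume_ge0.
have main j : H (X `&` F) + H (X `&` ~` F) <= H X + \sum_(j <= i <oo) H (L i).
  have cov : X `&` ~` F `<=` (X `&` U j.+1) `|` \bigcup_(i in ~` `I_j) L i.
    move=> x [Xx /bigU[N _ UN]].
    have [Uj|Uj] := pselect (U j.+1 x); [by left|right].
    have [|i Ui imin] := @ex_minnP (fun i => `[< U i x >]).
      by exists N; apply/asboolP.
    have ji : (j.+1 < i)%N.
      by rewrite ltnNge; apply/negP => ij; apply: Uj; apply: subU ij _ (asboolW Ui).
    exists i.-2 => /=; first by apply/negP; rewrite -leqNgt; lia.
    have i2 : i = i.-2.+2 by lia.
    split => //; split; first by rewrite -i2; exact: asboolW.
    move=> /asboolP/imin; lia.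
  apply: le_trans (leeD2l _ (le_hausdorff k cov)) _.
  apply: le_trans (leeD2l _ (outer_measureU2 _ _ _)) _; rewrite addeA.
  apply: leeD; last exact: outer_measure_sigma_subadditive_tail.
  have j0 : (0 < j.+2%:R^-1 :> R)%R by rewrite invr_gt0.
  apply: le_trans (hausdorff_separated j0 _) _.
    by move=> x z [_ Fx] [_ Uz]; rewrite enormB; exact: Uz.
  by apply: le_hausdorff => x [[]|[]].
have cv : (H X + \sum_(j <= i <oo) H (L i))%E @[j --> \oo] --> H X + 0.
  by apply: cvgeD; [rewrite fin_num_adde_defr|exact: cvg_cst|exact: nneseries_tail_cvg].
rewrite adde0 in cv; rewrite -(cvg_lim _ cv)//.
by apply: lime_ge; [apply/cvg_ex; exists (H X)|apply: nearW => j; exact: main].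
Qed.

End hausdorff_closed.

(** * A Poisson kernel *)

Section derivatives.
Context {R : realType} {n : nat}.
Local Notation V := 'rV[R]_n.
Implicit Types (x v : V) (f g : V -> R).

(** Reduces directional derivatives to derivatives of functions of one variable,
where the chain rule is available. *)
Lemma is_derive_line f x v (df : R) :
  is_derive x v f df <-> is_derive (0 : R) (1 : R) (fun t : R => f (t *: v + x)) df.
Proof.
have E : (fun h : R => h^-1 *: ((f \o shift x) (h *: v) - f x)) =
   (fun h : R => h^-1 *: (((fun t : R => f (t *: v + x)) \o shift (0 : R)) (h *: (1 : R)) - f (0 *: v + x))).
  apply/funext => h /=; rewrite scale0r add0r addr0.
  by rewrite [h *: (1 : R)]mulr1.
by split => -[H1 H2]; split; move: H1 H2; rewrite /derivable /derive E.
Qed.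

Lemma is_derive_comp1 (phi : R -> R) g x v (a b : R) :
  is_derive (g x) (1 : R) phi a -> is_derive x v g b ->
  is_derive x v (phi \o g) (a * b).
Proof.
move=> phia /is_derive_line gb; apply/is_derive_line.
apply: (@is_derive1_comp _ phi (fun t : R => g (t *: v + x))).
by rewrite scale0r add0r.
Qed.

Lemma is_derive_coord x v i : is_derive x v (fun y : V => y 0 i) (v 0 i).
Proof.
apply/is_derive_line.
have -> : (fun t : R => (t *: v + x) 0 i) = (fun t => t * v 0 i + x 0 i).
  by apply/funext => t; rewrite !mxE.
apply: is_derive_eq; by rewrite !(scaler0, addr0, add0r) [_ *: _]mulr1.
Qed.

Local Notation e := (delta_mx 0).

(** The function [w] is only known on [O]: this applies to [partial i u] once it
has been computed there. *)
Lemma C1_on_ext (O : set V) u (d : 'I_n -> V -> R) : open O ->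
  (forall x, O x -> {for x, continuous u}) ->
  (forall x i, O x -> is_derive x (e i) u (d i x)) ->
  (forall x i, O x -> {for x, continuous (d i)}) ->
  forall w, (forall x, O x -> w x = u x) ->
  C1_on O w /\ forall x i, O x -> partial i w x = d i x.
Proof.
move=> Oo uc ud dc w wu.
have near_O x (f g : V -> R) : (forall y, O y -> f y = g y) -> O x ->
    \forall y \near x, f y = g y.
  move=> fg Ox; have : nbhs x O by exact: open_nbhs_nbhs.
  by apply: filterS => y /fg.
have cont_ext x (f g : V -> R) : (forall y, O y -> f y = g y) -> O x ->
    {for x, continuous f} -> {for x, continuous g}.
  move=> fg Ox fc; rewrite /prop_for /continuous_at -(fg _ Ox).
  have H := near_O x f g fg Ox.
  exact: cvg_trans (near_eq_cvg H) fc.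
have wd x i : O x -> is_derive x (e i) w (d i x).
  move=> Ox; apply: near_eq_is_derive (ud x i Ox); apply: near_O Ox => y Oy.
  by rewrite wu.
have pw x i : O x -> partial i w x = d i x.
  by move=> Ox; have := wd x i Ox => -[].
split=> [x Ox|]; last exact: pw.
split; first by apply: cont_ext (uc _ Ox) => // y Oy; rewrite wu.
move=> i; split; first by have [] := wd x i Ox.
by apply: cont_ext (dc x i Ox) => // y Oy; rewrite pw.
Qed.

End derivatives.

Lemma open_neq {R : realType} {n : nat} (a : 'rV[R]_n) : open [set x | x != a].
Proof.
rewrite (_ : [set x | _] = ~` [set a]); last by apply/seteqP; split=> x /eqP.
exact/closed_openC/accessible_closed_set1/hausdorff_accessible/norm_hausdorff.
Qed.

(** The algebra of the Laplacian of [poisson], with [u = x - x0], [v = x - a],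
[N] the numerator of the kernel and [gk] the value of [enorm v ^- (n + k)]. *)
Lemma poisson_laplacian_sum {R : realType} {n : nat} (u v : 'rV[R]_n)
    (N g0 g2 g4 : R) :
  N = enorm v ^+ 2 - 2 * dotmul u v ->
  enorm v ^+ 2 * g2 = g0 -> enorm v ^+ 2 * g4 = g2 ->
  \sum_(i < n) (- (2 * (1 * g0 - n%:R * (u 0 i * v 0 i * g2))) -
    n%:R * (- (2 * u 0 i) * (v 0 i * g2) +
      N * (1 * g2 - n.+2%:R * (v 0 i * v 0 i * g4)))) = 0.
Proof.
move=> NE E0 E2.
transitivity (\sum_(i < n) ((- 2 * g0 - n%:R * N * g2) +
    4 * n%:R * g2 * (u 0 i * v 0 i) + n%:R * n.+2%:R * N * g4 * (v 0 i * v 0 i))).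
  by apply: eq_bigr => i _; ring.
rewrite !big_split/= -!mulr_sumr -[\sum_(i < n) u 0 i * v 0 i]/(dotmul u v).
rewrite -[\sum_(i < n) v 0 i * v 0 i]/(dotmul v v) -sqr_enorm.
have sumC (x : R) : \sum_(i < n) x = n%:R * x by rewrite sumr_const card_ord mulr_natl.
have -> : n.+2%:R = n%:R + 2 :> R by rewrite -natrD addn2.
rewrite !sumC -E0 -E2 NE.
move: (enorm v ^+ 2) (dotmul u v) => q l; ring.
Qed.

Section poisson.
Context {R : realType} {n : nat}.
Local Notation V := 'rV[R]_n.
Local Notation e := (delta_mx 0).
Variables (a x0 : V).
Implicit Types (x : V) (i j : 'I_n).

(** The Poisson kernel of the ball with centre [x0] and boundary point [a], up to
a constant factor. *)
Definition poisson x : R :=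
  (enorm (a - x0) ^+ 2 - enorm (x - x0) ^+ 2) / enorm (x - a) ^+ n.

Let O : set V := [set x | x != a].

Let num x : R := enorm (a - x0) ^+ 2 - enorm (x - x0) ^+ 2.
Let g k x : R := (enorm (x - a))^-1 ^+ k.

Let poissonE x : poisson x = num x * g n x.
Proof. by rewrite /poisson /g exprVn. Qed.

Let open_O : open O.
Proof. exact: open_neq. Qed.

Let enorm_gt0a x : O x -> 0 < enorm (x - a).
Proof. by rewrite enorm_gt0 subr_eq0. Qed.

Let g_sqr k x : O x -> enorm (x - a) ^+ 2 * g k.+2 x = g k x.
Proof.
move=> Ox; have x0' : enorm (x - a) != 0 by rewrite gt_eqF ?enorm_gt0a.
by rewrite /g -[k.+2]addn2 exprD mulrCA -exprMn divff// expr1n mulr1.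
Qed.

Let is_derive_sqr (c x : V) i :
  is_derive x (e i) (fun y : V => enorm (y - c) ^+ 2) (2 * (x 0 i - c 0 i)).
Proof.
have -> : (fun y : V => enorm (y - c) ^+ 2) =
   \sum_(k < n) (fun y : V => (y 0 k - c 0 k) ^+ 2).
  apply/funext => y; rewrite sqr_enorm fct_sumE; apply: eq_bigr => k _.
  by rewrite !mxE expr2.
have -> : 2 * (x 0 i - c 0 i) = \sum_(k < n) (2 * (x 0 k - c 0 k) * (e i : V) 0 k).
  rewrite (bigD1 i)//= mxE !eqxx mulr1 big1 ?addr0// => k ki.
  by rewrite mxE (negbTE ki) andbF mulr0.
apply: is_derive_sum => k.
have dk := is_derive_coord x (e i) k.
have : is_derive x (e i) ((fun y : V => y 0 k) - cst (c 0 k)) ((e i : V) 0 k - 0).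
  by apply: is_deriveB.
rewrite subr0 => dk'.
have := @is_deriveX _ _ _ 2 _ _ _ dk'.
by rewrite /= expr1 -[_ *: _]/(_ * _).
Qed.

Let is_derive_g k x i : O x ->
  is_derive x (e i) (g k) (- k%:R * (x 0 i - a 0 i) * g k.+2 x).
Proof.
move=> Ox; have x0' := enorm_gt0a Ox.
have sq : is_derive x (e i) (fun y : V => Num.sqrt (enorm (y - a) ^+ 2)) 
    ((2 * Num.sqrt (enorm (x - a) ^+ 2))^-1 * (2 * (x 0 i - a 0 i))).
  apply: (@is_derive_comp1 _ _ Num.sqrt (fun y : V => enorm (y - a) ^+ 2)) (is_derive_sqr a x i).
  by apply: is_derive1_sqrt; rewrite exprn_gt0.
have inv : is_derive (enorm (x - a)) (1 : R) (fun t : R => t^-1) (- (enorm (x - a)) ^- 2 *: (1 : R)).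
  apply: is_deriveV; by rewrite gt_eqF.
have E : (fun y : V => Num.sqrt (enorm (y - a) ^+ 2)) = (fun y => enorm (y - a)).
  by apply/funext => y; rewrite sqrtr_sqr ger0_norm// enorm_ge0.
rewrite E sqrtr_sqr ger0_norm ?enorm_ge0// in sq.
have dinv := @is_derive_comp1 _ _ (fun t : R => t^-1)
  (fun y : V => enorm (y - a)) _ _ _ _ inv sq.
have := @is_deriveX _ _ _ k _ _ _ dinv.
have -> : ((fun t : R => t^-1) \o (fun y : V => enorm (y - a))) ^+ k = g k.
  by apply/funext => y; rewrite /g exprfctE.
move=> H; apply: is_derive_eq H _; rewrite /= -[LHS]/(_ * _) -[_ *: 1]/(_ * 1) /g.
case: k => [|k]; first by rewrite !(mul0r, oppr0).
rewrite /= !exprS; set w := enorm (x - a) in x0' *; rewrite !exprVn.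
by field; rewrite ?expf_neq0// gt_eqF.
Qed.

Let g_cont k x : O x -> {for x, continuous (g k)}.
Proof.
move=> Ox; have h0 : enorm (y - a) @[y --> x] --> enorm (x - a).
  exact: continuous_enormB.
have h1 : (enorm (y - a))^-1 @[y --> x] --> (enorm (x - a))^-1.
  by apply: cvgV h0; rewrite gt_eqF ?enorm_gt0a.
exact: cvg_comp h1 (@exprn_continuous _ k _).
Qed.

Let contB (f h : V -> R) x : {for x, continuous f} -> {for x, continuous h} ->
  {for x, continuous (fun y => f y - h y)}.
Proof. by move=> fc hc; exact: (cvgB fc hc). Qed.

Let contD (f h : V -> R) x : {for x, continuous f} -> {for x, continuous h} ->
  {for x, continuous (fun y => f y + h y)}.
Proof. by move=> fc hc; exact: (cvgD fc hc). Qed.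

Let contM (f h : V -> R) x : {for x, continuous f} -> {for x, continuous h} ->
  {for x, continuous (fun y => f y * h y)}.
Proof. by move=> fc hc; exact: (cvgM fc hc). Qed.

Let contN (f : V -> R) x : {for x, continuous f} ->
  {for x, continuous (fun y => - f y)}.
Proof. by move=> fc; exact: (cvgN fc). Qed.

Let contC (c : R) x : {for x, continuous (fun _ : V => c)}.
Proof. exact: (@cvg_cst _ c _ (nbhs x)). Qed.

Let sqr_cont (c : V) x : {for x, continuous (fun y : V => enorm (y - c) ^+ 2)}.
Proof.
have h0 : enorm (y - c) @[y --> x] --> enorm (x - c) by exact: continuous_enormB.
exact: cvg_comp h0 (@exprn_continuous _ 2 _).
Qed.

Let num_cont x : {for x, continuous num}.
Proof. by apply: contB; [exact: contC|exact: sqr_cont]. Qed.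

Let coord_cont (c : V) i x : {for x, continuous (fun y : V => y 0 i - c 0 i)}.
Proof. by apply: contB; [exact: coord_continuous|exact: contC]. Qed.

Let is_derive_num x i : is_derive x (e i) num (- (2 * (x 0 i - x0 0 i))).
Proof.
rewrite -sub0r; apply: (@is_deriveB _ _ _ (cst (enorm (a - x0) ^+ 2)) _ _ _ 0 _).
exact: is_derive_sqr.
Qed.

Let is_derive_coordB (c : V) x i j :
  is_derive x (e j) (fun y : V => y 0 i - c 0 i) (i == j)%:R.
Proof.
have -> : (i == j)%:R = (e j : V) 0 i - 0 :> R by rewrite mxE eqxx subr0.
by apply: is_deriveB; exact: is_derive_coord.
Qed.

(* [d1 i] and [d2 i j] are the first and second partial derivatives of
   [poisson], by the rule that [g k] has the partial derivatives
   [- k%:R * (x 0 i - a 0 i) * g k.+2 x] *)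
Let d1 i x : R := - (2 * ((x 0 i - x0 0 i) * g n x)) -
  n%:R * (num x * ((x 0 i - a 0 i) * g n.+2 x)).

Let d2 i j x : R :=
  - (2 * ((i == j)%:R * g n x - n%:R * ((x 0 i - x0 0 i) * (x 0 j - a 0 j) * g n.+2 x))) -
  n%:R * (- (2 * (x 0 j - x0 0 j)) * ((x 0 i - a 0 i) * g n.+2 x) +
    num x * ((i == j)%:R * g n.+2 x -
      n.+2%:R * ((x 0 i - a 0 i) * (x 0 j - a 0 j) * g n.+4 x))).

Let is_derive_prod (f h : V -> R) x v (df dh d : R) :
  is_derive x v f df -> is_derive x v h dh -> df * h x + f x * dh = d ->
  is_derive x v (fun y => f y * h y) d.
Proof.
move=> H1 H2 <-; apply: is_derive_eq (is_deriveM H1 H2) _.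
by rewrite addrC [h x *: _]mulrC.
Qed.

Let is_derive_scale (f : V -> R) x v (c df d : R) :
  is_derive x v f df -> c * df = d -> is_derive x v (fun y => c * f y) d.
Proof. by move=> H1 <-; exact: is_deriveZ. Qed.

Let is_derive_d0 x i : O x -> is_derive x (e i) (fun y => num y * g n y) (d1 i x).
Proof.
move=> Ox; apply: (is_derive_prod (is_derive_num x i) (is_derive_g n i Ox)).
by rewrite /d1; ring.
Qed.

Let is_derive_d1 x i j : O x -> is_derive x (e j) (d1 i) (d2 i j x).
Proof.
move=> Ox.
have h1 := is_derive_prod (is_derive_coordB x0 x i j) (is_derive_g n j Ox) erefl.
have h2 := is_derive_prod (is_derive_coordB a x i j) (is_derive_g n.+2 j Ox) erefl.
have h3 := is_derive_scale (c := n%:R) (is_derive_prod (is_derive_num x j) h2 erefl) erefl.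
have h4 := is_deriveB (is_deriveN (is_derive_scale (c := 2) h1 erefl)) h3.
by apply: is_derive_eq h4 _; rewrite /d2; ring.
Qed.

Let d1_cont i x : O x -> {for x, continuous (d1 i)}.
Proof.
move=> Ox; apply: contB.
  apply: contN; apply: contM; first exact: contC.
  by apply: contM; [exact: coord_cont|exact: g_cont].
apply: contM; first exact: contC.
apply: contM; first exact: num_cont.
by apply: contM; [exact: coord_cont|exact: g_cont].
Qed.

Let d2_cont i j x : O x -> {for x, continuous (d2 i j)}.
Proof.
move=> Ox; apply: contB.
  apply: contN; apply: contM; first exact: contC.
  apply: contB; first by apply: contM; [exact: contC|exact: g_cont].
  apply: contM; first exact: contC.
  apply: contM; last exact: g_cont.
  by apply: contM; exact: coord_cont.
apply: contM; first exact: contC.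
apply: contD.
  apply: contM; last by apply: contM; [exact: coord_cont|exact: g_cont].
  by apply: contN; apply: contM; [exact: contC|exact: coord_cont].
apply: contM; first exact: num_cont.
apply: contB; first by apply: contM; [exact: contC|exact: g_cont].
apply: contM; first exact: contC.
apply: contM; last exact: g_cont.
by apply: contM; exact: coord_cont.
Qed.

Lemma poisson_continuous x : x != a -> {for x, continuous poisson}.
Proof.
move=> Ox; rewrite (_ : poisson = fun y => num y * g n y); last exact/funext.
by apply: contM; [exact: num_cont|exact: g_cont].
Qed.

(** The derivative in the direction [a - x0] of the fundamental solution with
pole [a], up to a constant factor. *)
Definition dipole x : R := dotmul (a - x) (a - x0) / enorm (x - a) ^+ n.

(** Polarization: twice the numerator of [dipole] is
|x - a|^2 + |a - x0|^2 - |x - x0|^2. *)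
Lemma dipoleE x :
  dipole x = 2^-1 * (poisson x + enorm (x - a) ^+ 2 / enorm (x - a) ^+ n).
Proof.
rewrite /dipole /poisson.
have := sqr_enormB (a - x) (a - x0).
rewrite (_ : a - x - (a - x0) = x0 - x); last by rewrite opprB addrC subrKA.
rewrite (enormB x0 x) (enormB a x); move: (dotmul _ _) => d.
by move=> ->; move: ((enorm (x - a) ^+ n)^-1) => k; field.
Qed.

Lemma dipole_continuous x : x != a -> {for x, continuous dipole}.
Proof.
move=> Ox; rewrite (_ : dipole = fun y => 2^-1 * (poisson y + enorm (y - a) ^+ 2 * g n y)).
  apply: contM; first exact: contC.
  apply: contD; first exact: poisson_continuous.
  by apply: contM; [exact: sqr_cont|exact: g_cont].
by apply/funext => y; rewrite dipoleE /g exprVn.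
Qed.

Lemma poisson_harmonic : harmonic_on [set x | x != a] poisson.
Proof.
have [C1 P1] : C1_on O poisson /\ forall x i, O x -> partial i poisson x = d1 i x.
  apply: (C1_on_ext (u := fun y => num y * g n y) open_O) => [x Ox|x i|x i|x _].
  - by apply: contM; [exact: num_cont|exact: g_cont].
  - exact: is_derive_d0.
  - exact: d1_cont.
  - exact: poissonE.
have C2 i : C1_on O (partial i poisson) /\
    forall x j, O x -> partial j (partial i poisson) x = d2 i j x.
  apply: (C1_on_ext (u := d1 i) open_O) => [x Ox|x j|x j|x Ox].
  - exact: d1_cont.
  - exact: is_derive_d1.
  - exact: d2_cont.
  - exact: P1.
split; first by split; [exact: C1|move=> i; case: (C2 i)].
move=> x Ox; transitivity (\sum_(i < n) d2 i i x).
  by apply: eq_bigr => i _; rewrite (C2 i).2.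
have numE : num x = enorm (x - a) ^+ 2 - 2 * dotmul (x - x0) (x - a).
  have H := sqr_enormB (x - x0) (x - a).
  rewrite (_ : x - x0 - (x - a) = a - x0) in H; last by rewrite opprB addrC subrKA.
  by rewrite /num H; ring.
apply: etrans (poisson_laplacian_sum numE (g_sqr n Ox) (g_sqr n.+2 Ox)).
by apply: eq_bigr => i _; rewrite /d2 eqxx !mxE.
Qed.

End poisson.

(** * The boundary of a bounded open set *)

Section boundary_geometry.
Context {R : realType} {n : nat}.
Local Notation V := 'rV[R]_n.
Variables (W : set V) (x0 : V).
Hypotheses (W_open : open W) (Wx0 : W x0).

Lemma closed_boundary (A : set V) : closed (boundary A).
Proof.
rewrite /boundary setDE; apply: closedI; first exact: closed_closure.
exact/open_closedC/open_interior.
Qed.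

Lemma compact_boundary (A : set V) : bounded_set A -> compact (boundary A).
Proof.
move=> [M [_ MA]]; apply: bounded_closed_compact; last exact: closed_boundary.
exists (M + 1); split => [|N MN x [clx _]]; first exact: num_real.
have [y [Ay]] := clx _ (nbhs_eball x ltr01); rewrite /eball/= => yx.
have yN : `|y| <= N - 1 by apply: (MA (N - 1)) => //; rewrite ltrBrDr.
have := ler_normD (x - y) y; rewrite subrK => /le_trans; apply.
have := norm_le_enorm (x - y); rewrite enormB => xy.
have : `|x - y| <= 1 by apply: le_trans xy (ltW yx).
by move: yN; lra.
Qed.

(** The supremum of the parameters at which the segment is in [W] gives the
point. *)
Lemma segment_meets_boundary (y : V) : ~ W y ->
  exists2 t : R, 0 <= t <= 1 & boundary W (x0 + t *: (y - x0)).
Proof.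
move=> nWy; pose gam (t : R) : V := x0 + t *: (y - x0).
have gamc : continuous gam.
  move=> t; apply: cvgD; first exact: cvg_cst.
  by apply: cvgZ; [exact: cvg_id|exact: cvg_cst].
pose S : set R := [set t | 0 <= t <= 1 /\ W (gam t)].
have S0 : S 0 by split; [rewrite lexx ler01|rewrite /gam scale0r addr0].
have Sub : ubound S 1 by move=> t [/andP[]].
have Ssup : has_sup S by split; [exists 0|exists 1].
pose T := sup S.
have T0 : 0 <= T by apply: ub_le_sup S0; exists 1.
have T1 : T <= 1 by apply: ge_sup => //; exists 0.
exists T; first by rewrite T0.
split.
  move=> U nU.
  have : nbhs T (gam @^-1` U) by apply: gamc.
  move=> /nbhs_normP[e /= e0 eU].
  have [t [t01 Wt] Tt] := sup_adherent e0 Ssup.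
  exists (gam t); split => //; apply: eU => /=.
  have tT : t <= T by apply: ub_le_sup; [exists 1|split].
  by rewrite ger0_norm ?subr_ge0// ltrBlDr -ltrBlDl.
rewrite (interior_id _).1// => WT.
have T1' : T < 1.
  rewrite lt_neqAle T1 andbT; apply/eqP => TE; apply: nWy.
  by move: WT; rewrite TE scale1r addrC subrK.
have : nbhs T (gam @^-1` W) by apply: gamc; exact: open_nbhs_nbhs.
move=> /nbhs_normP[e /= e0 eW].
pose t := Num.min (T + e / 2) 1.
have Tt : T < t by rewrite lt_min T1' ltrDl divr_gt0.
have : t <= T.
  apply: ub_le_sup; first by exists 1.
  split.
    by rewrite (le_trans T0 (ltW Tt))/= ge_min lexx orbT.
  apply: eW => /=; rewrite ltr0_norm ?subr_lt0// opprB ltrBlDl.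
  apply: (@le_lt_trans _ _ (T + e / 2)); first by rewrite ge_min lexx.
  by rewrite ltrD2l ltr_pdivrMr// ltr_pMr// ltr1n.
by rewrite leNgt Tt.
Qed.

Section touching.
Variable r : R.
Hypothesis (r_le : forall x, boundary W x -> r <= enorm (x - x0)).

(** The segment from [x0] to [a] leaves [W] through a boundary point. *)
Lemma ball_in_domain (a : V) : ~ W a -> r <= enorm (a - x0).
Proof.
move=> /segment_meets_boundary[t /andP[t0 t1] /r_le].
rewrite addrC addKr enormZ ger0_norm// => /le_trans; apply.
by rewrite ler_piMl// enorm_ge0.
Qed.

(** A far point of the ray is outside the bounded set [W]. *)
Lemma boundary_rays : bounded_set W -> 0 < r -> forall v, enorm v = r -> exists x,
  [/\ boundary W x, r <= enorm (x - x0) & v = (r / enorm (x - x0)) *: (x - x0)].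
Proof.
move=> [M [_ MW]] r0 v vr.
have {}MW x : W x -> enorm x <= n%:R * (M + 1).
  move=> Wx; apply: le_trans (enorm_le_norm _) _.
  by rewrite ler_wpM2l//; apply: MW => //; rewrite ltrDl.
pose c := (n%:R * (M + 1) + enorm x0 + 1) / r.
have c0 : 0 < c.
  rewrite divr_gt0// ltr_wpDl// addr_ge0 ?enorm_ge0//.
  exact: le_trans (enorm_ge0 _) (MW _ Wx0).
have : ~ W (x0 + c *: v).
  move=> /MW; have := ler_enormD (x0 + c *: v) (- x0).
  rewrite addrC addKr enormN enormZ vr gtr0_norm// divfK ?gt_eqF//; lra.
move=> /segment_meets_boundary[t /andP[t0 t1]].
rewrite [x0 + _ - x0]addrC addKr scalerA; set x := x0 + _ => bx.
have xE : x - x0 = (t * c) *: v by rewrite /x addrC addKr.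
exists x; split => //; first exact: r_le.
have tc0 : 0 <= t * c by apply: mulr_ge0 => //; exact: ltW.
have := r_le bx; rewrite xE enormZ vr ger0_norm// => H.
have tc : 0 < t * c.
  by rewrite -(pmulr_lgt0 _ r0); exact: lt_le_trans H.
rewrite scalerA (_ : _ * _ = 1) ?scale1r//.
move: (t * c) tc => q q0; field.
by rewrite (gt_eqF q0) (gt_eqF r0).
Qed.

End touching.
End boundary_geometry.

(** * Integration over the boundary *)

Section surface_integration.
Local Open Scope ereal_scope.
Context {R : realType} {n : nat}.
Local Notation V := 'rV[R]_n.
Local Notation T := (caratheodory_type (surface_outer R n)).
Local Notation mu := (surface_measure R n).

Lemma measurable_closed (A : set T) : closed (A : set V) -> measurable A.
Proof. exact: caratheodory_closed. Qed.

Lemma measurable_open (A : set T) : open (A : set V) -> measurable A.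
Proof.
by move=> oA; rewrite -(setCK A); apply: measurableC; apply: measurable_closed; exact: open_closedC.
Qed.

(** Continuity makes [f] bounded on the compact set and its superlevel sets
relatively open in it. *)
Lemma continuous_integrable (O K : set V) (f : V -> R) : open O -> compact K ->
  K `<=` O -> {in O, continuous f} -> mu K < +oo ->
  mu.-integrable K (EFin \o f).
Proof.
move=> oO cK KO fc Kfin.
have clK : closed K by apply: compact_closed => //; exact: norm_hausdorff.
have mK : measurable (K : set T) by exact: measurable_closed.
apply: measurable_bounded_integrable => //.
  apply: (measurability (@RGenOInfty.G R)); first exact: RGenOInfty.measurableE.
  move=> _ [_ [t ->] <-].
  have oU : open (O `&` f @^-1` `]t, +oo[).
    rewrite openE => x [Ox /= ftx].
    have fx : f @ x --> f x by apply: fc; exact/mem_set.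
    apply: filterI; first by apply: open_nbhs_nbhs.
    apply: fx; apply: open_nbhs_nbhs; split => //; exact: interval_open.
  rewrite (_ : K `&` _ = K `&` (O `&` f @^-1` `]t, +oo[)).
    apply: measurableI => //; exact: measurable_open.
  by rewrite setIA (setIidl KO).
have wK : {within K, continuous f}.
  by apply: continuous_in_subspaceT => x /set_mem/KO Ox; apply: fc; exact/mem_set.
have [M [Mr MK]] := compact_bounded (continuous_compact wK cK).
by exists M; split => // M' MM' x Kx; apply: (MK M') => //; exists x.
Qed.

End surface_integration.

(** This includes filters [F] that contain the empty set, where the value is
[+oo]; they occur below when no point outside the closed domain tends to [z]. *)
Lemma limf_einf_ge {R : realType} {T : choiceType} {X : filteredType T}
    (f : X -> \bar R) (F : set_system X) (c : R) :
  (forall e : R, 0 < e -> F [set x | ((c - e)%:E <= f x)%E]) ->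
  (c%:E <= limf_einf f F)%E.
Proof.
move=> H; rewrite limf_einfE; apply/lee_addgt0Pr => e e0.
rewrite -leeBlDr//; set U := [set x | ((c - e)%:E <= f x)%E].
apply: (@le_trans _ _ (ereal_inf (f @` U))).
  by apply: le_ereal_inf_tmp => _ [x xU <-]; rewrite -EFinB.
by apply: ereal_sup_ubound; exists U => //; exact: H.
Qed.

(** * The flatness bound *)

Section pseudosphere_bound.
Local Open Scope ereal_scope.
Context {R : realType} {n : nat}.
Local Notation V := 'rV[R]_n.
Local Notation T := (caratheodory_type (surface_outer R n)).
Local Notation mu := (surface_measure R n).
Variables (W : set V) (x0 : V) (r : R).
Hypotheses (W_open : open W) (W_bounded : bounded_set W) (Wx0 : W x0)
  (fin_area : mu (boundary W) < +oo) (area_gt0 : 0 < mu (boundary W))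
  (r_le : forall x, boundary W x -> (r <= enorm (x - x0))%R) (r_ge0 : (0 <= r)%R)
  (W_pseudosphere : harmonic_pseudosphere W x0).

(** Near [z] the integral of [dipole] is at least half that of [poisson], by
[dipoleE]. The latter is its integral over the whole boundary, known from the
mean value property, minus its integral away from [z], where the kernel is
bounded by [c] because boundary points are at distance at least [r] from
[x0]. *)
Lemma boundary_integral_lower (z a : V) (rho : R) : (0 < rho)%R ->
  ~ closure W a -> (enorm (a - z) < rho / 2)%R ->
  ((fine (mu (boundary W)) / 2) * (enorm (a - x0) ^+ 2 / enorm (a - x0) ^+ n -
    (enorm (a - x0) ^+ 2 - r ^+ 2) / (rho / 2) ^+ n))%:E <=
  \int[mu]_(x in boundary W `&` eball z rho)
    (dotmul (a - x) (a - x0) / enorm (x - a) ^+ n)%:E.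
Proof.
move=> rho0 aW az; set G := boundary W; set s := fine (mu G).
have nWa : ~ W a by move=> /subset_closure.
have clG : closed G by exact: closed_boundary.
have GW : G `<=` closure W by move=> x [].
have cG : compact G by exact: compact_boundary.
pose O : set V := [set x | x != a].
have oO : open O by exact: open_neq.
have WO : closure W `<=` O by move=> x Wx; apply/eqP => xa; apply: aW; rewrite -xa.
have GO : G `<=` O by move=> x /GW/WO.
pose K := poisson a x0.
have Kc : {in O, continuous K} by move=> x /set_mem; exact: poisson_continuous.
have sE : mu G = s%:E by rewrite fineK// ge0_fin_numE// ltW.
have s0 : (0 < s)%R by rewrite -lte_fin -sE.
have iK : mu.-integrable G (EFin \o K) := continuous_integrable oO cG GO Kc fin_area.
have ih : mu.-integrable G (EFin \o dipole a x0).
  by apply: (continuous_integrable oO cG GO _ fin_area) => x /set_mem; exact: dipole_continuous.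
have KG : \int[mu]_(x in G) (K x)%:E = (s * K x0)%:E.
  have hK : harmonic_on W K.
    have [[C1 C2] L] := poisson_harmonic a x0.
    have WO' x : W x -> O x by move=> /subset_closure/WO.
    by split; [split=> [x /WO'/C1//|i x /WO'/(C2 i)]|move=> x /WO'/L].
  have cK : {within closure W, continuous K}.
    by apply: continuous_in_subspaceT => x /set_mem/WO Ox; apply: Kc; exact/mem_set.
  have := W_pseudosphere hK cK; rewrite /boundary_mean -/G -/s => E.
  by rewrite EFinM E muleA -EFinM divff ?gt_eqF// mul1e.
pose B : set T := eball z rho.
have mG : measurable (G : set T) by exact: measurable_closed.
have mB : measurable B by apply: measurable_open; exact: open_eball.
have mE : measurable (G `&` B : set T) by exact: measurableI.
have mE' : measurable (G `\` B : set T) by exact: measurableD.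
have EG : G `&` B `<=` G by exact: subIsetl.
have E'G : G `\` B `<=` G by exact: subDsetl.
have iKE := integrableS mG mE EG iK; have iKE' := integrableS mG mE' E'G iK.
have ihE := integrableS mG mE EG ih.
have split_K : (s * K x0)%:E =
    \int[mu]_(x in G `&` B) (K x)%:E + \int[mu]_(x in G `\` B) (K x)%:E.
  have := @integral_setU _ T R mu (G `&` B) (G `\` B) (EFin \o K) mE mE'.
  rewrite setUIDK -KG; apply; first exact: measurable_int iK.
  by apply/disj_setPS => x [[_ Bx] [_]].
set c := ((enorm (a - x0) ^+ 2 - r ^+ 2) / (rho / 2) ^+ n)%R.
have ra : (r <= enorm (a - x0))%R by exact: ball_in_domain nWa.
have c0 : (0 <= c)%R.
  apply: divr_ge0; last by rewrite exprn_ge0// divr_ge0// ltW.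
  by rewrite subr_ge0 lerXn2r ?nnegrE ?enorm_ge0.
have K_out x : (G `\` B) x -> (K x <= c)%R.
  move=> [Gx /negP]; rewrite /B /eball/= -leNgt => xz.
  have xa : (rho / 2 <= enorm (x - a))%R.
    by have := ler_enorm_dist x a z; lra.
  have h0 : (0 < rho / 2)%R by rewrite divr_gt0.
  have p0 : (0 < (rho / 2) ^+ n)%R by rewrite exprn_gt0.
  have pa : ((rho / 2) ^+ n <= enorm (x - a) ^+ n)%R.
    by rewrite lerXn2r ?nnegrE ?enorm_ge0// ltW.
  apply: (@le_trans _ _ ((enorm (a - x0) ^+ 2 - r ^+ 2) / enorm (x - a) ^+ n)%R).
    apply: ler_wpM2r; first by rewrite invr_ge0 exprn_ge0// enorm_ge0.
    by rewrite lerD2l lerN2 lerXn2r ?nnegrE ?enorm_ge0//; exact: r_le.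
  apply: ler_wpM2l; first by rewrite subr_ge0 lerXn2r ?nnegrE ?enorm_ge0.
  by rewrite lef_pV2 ?posrE// (lt_le_trans p0).
have out : \int[mu]_(x in G `\` B) (K x)%:E <= (c * s)%:E.
  apply: (@le_trans _ _ (\int[mu]_(x in G `\` B) c%:E)).
    apply: le_integral => //; last by move=> x /set_mem/K_out; rewrite lee_fin.
    apply: (integrableS mG mE' E'G).
    by apply: (continuous_integrable oO cG GO _ fin_area (f := cst c)) => x _; exact: cst_continuous.
  rewrite integral_cst// [leRHS]EFinM -sE; apply: lee_wpmul2l; first by rewrite lee_fin.
  exact: le_measure (mem_set mE') (mem_set mG) E'G.
have inn : (2^-1)%:E * \int[mu]_(x in G `&` B) (K x)%:E <=
    \int[mu]_(x in G `&` B) (dipole a x0 x)%:E.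
  rewrite -integralZl//; apply: le_integral => //; first exact: integrableZl.
  move=> x _; rewrite -EFinM lee_fin dipoleE mulrDr lerDl.
  by rewrite mulr_ge0 ?invr_ge0// divr_ge0 ?exprn_ge0 ?enorm_ge0.
apply: le_trans inn; move: split_K out.
have := integrable_fin_num mE iKE; have := integrable_fin_num mE' iKE'.
move=> /fineK <- /fineK <-; set I' := fine _; set I := fine _.
rewrite -EFinD -EFinM !lee_fin => -[sK] out.
have Kx0 : K x0 = (enorm (a - x0) ^+ 2 / enorm (a - x0) ^+ n)%R.
  by rewrite /K /poisson subrr enorm0 expr0n subr0 (enormB x0).
rewrite -Kx0; lra.
Qed.

End pseudosphere_bound.

Theorem corollary1p7 (R : realType) (n : nat) (W : set 'rV[R]_n)
    (x0 : 'rV[R]_n) :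
  (2 <= n)%N ->
  open W ->
  bounded_set W ->
  (surface_measure R n (boundary W) < +oo)%E ->
  W x0 ->
  harmonic_pseudosphere W x0 ->
  forall z : 'rV[R]_n, touching_set W x0 z -> (1 <= flatness_index W x0 z)%E.
Proof.
case: n W x0 => [|[|m']]// W x0 _ W_open W_bounded fin_area Wx0 psW z [zb z_near].
set n := m'.+2 in W x0 W_open W_bounded fin_area Wx0 psW z zb z_near *.
set G := boundary W in fin_area zb z_near *.
pose r := enorm (z - x0); pose w := unit_ball_volume R n.
have r_le x : G x -> r <= enorm (x - x0).
  move=> Gx; rewrite /r enormB z_near enormB; apply: ge_inf; last by exists x.
  by exists 0 => _ [y _ <-]; exact: enorm_ge0.
have r0 : 0 < r.
  rewrite enorm_gt0 subr_eq0; apply/eqP => zx0; case: zb => _; apply.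
  by rewrite (interior_id _).1// zx0.
have w0 : 0 < w by exact: unit_ball_volume_gt0.
have area : ((n%:R * w * r ^+ m'.+1)%:E <= surface_measure R n G)%E :=
  area_surrounding r0 (boundary_rays W_open Wx0 r_le W_bounded r0) fin_area.
have area0 : (0 < surface_measure R n G)%E.
  by apply: lt_le_trans area; rewrite lte_fin !mulr_gt0// exprn_gt0.
pose s := fine (surface_measure R n G).
have s_ge : n%:R * w * r ^+ m'.+1 <= s.
  by rewrite -lee_fin fineK// ge0_fin_numE// ltW.
pose c := n%:R * w * r / 2.
have c_le : c <= s / 2 * (r ^+ 2 / r ^+ n).
  have -> : r ^+ 2 / r ^+ n = (r ^+ m')^-1.
    have -> : r ^+ n = r ^+ m' * r ^+ 2 by rewrite -exprD addn2.
    by field; rewrite expf_neq0 gt_eqF.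
  rewrite ler_pdivlMr ?exprn_gt0//.
  apply: (@le_trans _ _ (n%:R * w * r ^+ m'.+1 / 2)); last by rewrite ler_pM2r.
  by rewrite /c exprS le_eqVlt; apply/orP; left; apply/eqP; field.
suff inner (rho : R) : 0 < rho ->
    (c%:E <= limf_einf (fun a : 'rV[R]_n =>
      \int[surface_measure R n]_(x in G `&` eball z rho)
        (dotmul (a - x) (a - x0) / enorm (x - a) ^+ n)%:E)
      (within (~` closure W) (nbhs z)))%E.
  rewrite /flatness_index -/G -/r -/w.
  have K0 : 0 < 2 / (n%:R * w * r) by rewrite divr_gt0// !mulr_gt0.
  have -> : 1%E = ((2 / (n%:R * w * r))%:E * c%:E)%E.
    rewrite -EFinM /c; congr EFin; field.
    by rewrite (gt_eqF w0) (gt_eqF r0) /= pnatr_eq0.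
  rewrite lee_pmul2l//; apply: limf_einf_ge => e e0.
  near=> rho; rewrite /=; apply: le_trans (inner rho _); last first.
    by near: rho; exact: nbhs_right_gt.
  by rewrite lee_fin gerBl ltW.
move=> rho0; apply: limf_einf_ge => e e0.
pose f (a : 'rV[R]_n) := s / 2 * (enorm (a - x0) ^+ 2 / enorm (a - x0) ^+ n -
    (enorm (a - x0) ^+ 2 - r ^+ 2) / (rho / 2) ^+ n).
have fz : f z = s / 2 * (r ^+ 2 / r ^+ n) by rewrite /f subrr mul0r subr0.
have fc : f a @[a --> z] --> f z.
  have c1 : enorm (a - x0) @[a --> z] --> r by exact: continuous_enormB.
  have c2 : enorm (a - x0) ^+ 2 @[a --> z] --> r ^+ 2.
    exact: cvg_comp c1 (@exprn_continuous _ 2 _).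
  have cn : enorm (a - x0) ^+ n @[a --> z] --> r ^+ n.
    exact: cvg_comp c1 (@exprn_continuous _ n _).
  have rn0 : r ^+ n != 0 by rewrite expf_neq0// gt_eqF.
  have cst k := @cst_continuous 'rV[R]_n R k z.
  exact: cvgM (cst _) (cvgB (cvgM c2 (cvgV rn0 cn)) (cvgM (cvgB c2 (cst _)) (cst _))).
have near_f : \forall a \near z, c - e <= f a.
  move/cvgrPdist_le : fc => /(_ _ e0); apply: filterS => a; rewrite fz ler_norml.
  by move: c_le; lra.
have rho2 : 0 < rho / 2 by rewrite divr_gt0.
have near_z := nbhs_eball z rho2.
rewrite /within/=; near=> a => aW.
apply: (@le_trans _ _ (f a)%:E); first by rewrite lee_fin; near: a.
apply: (boundary_integral_lower W_open W_bounded Wx0 fin_area area0 r_le (ltW r0) psW rho0 aW).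
by near: a.
Unshelve. all: by end_near.
Qed.
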